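(* Let $k$ be an algebraically closed field of characteristic zero (with $\sigma=\mathrm{id}$ on $k$). Suppose $\phi:V\to V$ is an automorphism of an irreducible algebraic variety $V$ over $k$ such that $(V,\phi)$ is isotrivial. If $(V,\phi)$ admits no nonconstant invariant rational functions then there is $a\in V(k)$ such that the orbit of $a$ under $\phi$ is Zariski dense in $V$.
   Context: A rational dynamical system over $k$ is an irreducible variety $V$ over $k$ equipped with a dominant rational map $\phi:V\dashrightarrow V$ over $k$. A rational map $g:V\dashrightarrow W$ is equivariant $(V,\phi)\dashrightarrow(W,\psi)$ if $\psi\circ g=g\circ\phi$. An invariant subvariety of $(V,\phi)$ is an irreducible Zariski closed $X\subseteq V$ over $k$ with $X\cap\mathrm{dom}(\phi)\neq\emptyset$ and $\phi(X)$ Zariski dense in $X$. $(V,\phi)$ is isotrivial if there exist a rational dynamical system $(Z,\psi)$ over $k$, an $\ell\ge0$, an invariant subvariety $Y$ of $(\mathbb{A}^\ell\times Z,\mathrm{id}\times\psi)$, and an equivariant birational map $g:(V\times Z,\phi\times\psi)\dashrightarrow(Y,\mathrm{id}\times\psi)$ over $k$ commuting with the projections to $Z$. An invariant rational function on $(V,\phi)$ is $\lambda\in k(V)$ with $\lambda\circ\phi=\lambda$; it is nonconstant if $\lambda\notin k$. *)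

(* Defs.v *)
From HB Require Import structures.
From mathcomp Require Import all_boot all_order all_algebra.
From mathcomp Require Import boolp classical_sets functions filter.
From mathcomp Require Import topology_structure initial_topology subtype_topology.
From mathcomp Require Import mpoly.

Set Implicit Arguments.
Unset Strict Implicit.
Unset Printing Implicit Defensive.

Import GRing.Theory.
Local Open Scope classical_set_scope.
Local Open Scope ring_scope.

(* Varieties over an algebraically closed field k are handled classically, as
   spaces of k-points with a sheaf of k-valued functions (Serre, FAC).  The sheaf
   is given by its germs: [reg x f] says that the function f, whose values
   away from x are irrelevant, is regular at x; the sections over an open set U
   are the functions that are regular at every point of U. *)
Record kspace (k : fieldType) := KSpace {
  kpts :> topologicalType;
  reg : kpts -> (kpts -> k) -> Prop;
  reg_local : forall x f g,
    (\forall y \near x, f y = g y) -> reg x f -> reg x g;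
  reg_open : forall x f, reg x f -> \forall y \near x, reg y f;
  reg_cst : forall x c, reg x (fun=> c);
  reg_add : forall x f g, reg x f -> reg x g -> reg x (fun y => f y + g y);
  reg_mul : forall x f g, reg x f -> reg x g -> reg x (fun y => f y * g y);
  reg_neq0 : forall x f, reg x f -> f x != 0 -> \forall y \near x, f y != 0;
  reg_inv : forall x f, reg x f -> f x != 0 -> reg x (fun y => (f y)^-1)
}.

Section Morphisms.
Context (k : fieldType).
Implicit Types V W X : kspace k.

Definition regular_at V W (x : V) (f : V -> W) : Prop :=
  {for x, continuous f} /\ forall h, reg (f x) h -> reg x (h \o f).

Definition morphism V W (f : V -> W) : Prop := forall x, regular_at x f.

Definition isomorphism V W (f : V -> W) : Prop :=
  morphism f /\ exists g : W -> V, [/\ morphism g, cancel f g & cancel g f].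

Definition automorphism V (f : V -> V) : Prop := isomorphism f.

Lemma regular_at_comp V W X (f : V -> W) (g : W -> X) x :
  regular_at x f -> regular_at (f x) g -> regular_at x (g \o f).
Proof.
move=> [cf rf] [cg rg]; split; first exact: continuous_comp.
by move=> h /rg /rf.
Qed.

Lemma regular_at_id V (x : V) : regular_at x (@id V).
Proof. by split=> // U. Qed.

End Morphisms.

Section AffineSpace.
Context (k : fieldType) (n : nat).

(* An alias, so that the Zariski topology does not interfere with the topology
   that the library puts on matrices. *)
Definition affine_pts : Type := 'rV[k]_n.
HB.instance Definition _ := Choice.on affine_pts.

Definition peval (p : {mpoly k[n]}) (x : affine_pts) : k :=
  p.@[fun i => (x : 'rV[k]_n) ord0 i].

Lemma pevalD p q x : peval (p + q) x = peval p x + peval q x.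
Proof. exact: mevalD. Qed.

Lemma pevalM p q x : peval (p * q) x = peval p x * peval q x.
Proof. exact: mevalM. Qed.

Lemma pevalC c x : peval c%:MP x = c.
Proof. exact: mevalC. Qed.

Lemma peval1 x : peval 1 x = 1.
Proof. exact: meval1. Qed.

Definition zariski_open : set_system affine_pts :=
  [set O | forall x, O x ->
     exists2 p, peval p x != 0 & forall y, peval p y != 0 -> O y].

Let zariskiT : zariski_open setT.
Proof. by move=> x _; exists 1 => //; rewrite peval1 oner_neq0. Qed.

Let zariskiI : setI_closed zariski_open.
Proof.
move=> A B oA oB x [/oA[p px pA] /oB[q qx qB]].
exists (p * q); rewrite ?pevalM; first exact: mulf_neq0.
by move=> y; rewrite pevalM mulf_eq0 negb_or => /andP[/pA ? /qB ?].
Qed.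

Let zariskiU (I : Type) (f : I -> set affine_pts) :
  (forall i, zariski_open (f i)) -> zariski_open (\bigcup_i f i).
Proof.
move=> oF x [i _ /oF[p px pf]]; exists p => // y /pf fy.
by exists i.
Qed.

HB.instance Definition _ :=
  isOpenTopological.Build affine_pts zariskiT zariskiI zariskiU.

Lemma affine_openE (O : set affine_pts) : open O = zariski_open O.
Proof. by []. Qed.

Lemma nbhs_peval (p : {mpoly k[n]}) (x : affine_pts) :
  peval p x != 0 -> \forall y \near x, peval p y != 0.
Proof.
move=> px; rewrite /prop_near1 nbhsE; exists [set y | peval p y != 0] => //.
by split=> //; rewrite affine_openE => y py; exists p.
Qed.

Definition affine_reg (x : affine_pts) (f : affine_pts -> k) : Prop :=
  exists p q, peval q x != 0 /\
    forall y, peval q y != 0 -> f y = peval p y / peval q y.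


Let affine_local (x : affine_pts) f g :
  (\forall y \near x, f y = g y) -> affine_reg x f -> affine_reg x g.
Proof.
rewrite /prop_near1 nbhsE => -[O [] /[1!affine_openE] oO Ox Ofg] [p [q [qx pq]]].
have [r rx rO] := oO x Ox.
exists (p * r), (q * r); rewrite pevalM; split; first exact: mulf_neq0.
move=> y; rewrite !pevalM mulf_eq0 negb_or => /andP[qy ry].
rewrite -Ofg ?pq //; last exact: rO.
by rewrite -mulf_div divff ?mulr1.
Qed.

Let affine_open (x : affine_pts) f : affine_reg x f -> \forall y \near x, affine_reg y f.
Proof.
move=> [p [q [qx pq]]]; apply: filterS (nbhs_peval qx) => y qy.
by exists p, q.
Qed.

Let affine_cst (x : affine_pts) c : affine_reg x (fun=> c).
Proof.
exists c%:MP, 1; rewrite peval1 oner_neq0; split=> // y _.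
by rewrite pevalC peval1 divr1.
Qed.

Let affine_add (x : affine_pts) f g :
  affine_reg x f -> affine_reg x g -> affine_reg x (fun y => f y + g y).
Proof.
move=> [p [q [qx pq]]] [r [s [sx rs]]]; exists (p * s + r * q), (q * s).
rewrite pevalM; split=> [|y]; first exact: mulf_neq0.
rewrite pevalM mulf_eq0 negb_or => /andP[qy sy].
by rewrite pq // rs // addf_div // pevalD !pevalM.
Qed.

Let affine_mul (x : affine_pts) f g :
  affine_reg x f -> affine_reg x g -> affine_reg x (fun y => f y * g y).
Proof.
move=> [p [q [qx pq]]] [r [s [sx rs]]]; exists (p * r), (q * s).
rewrite pevalM; split=> [|y]; first exact: mulf_neq0.
rewrite pevalM mulf_eq0 negb_or => /andP[qy sy].
by rewrite pq // rs // mulf_div pevalM.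
Qed.

Let affine_neq0 (x : affine_pts) f :
  affine_reg x f -> f x != 0 -> \forall y \near x, f y != 0.
Proof.
move=> [p [q [qx pq]]]; rewrite pq // mulf_eq0 negb_or => /andP[px _].
near=> y; have qy : peval q y != 0 by near: y; exact: nbhs_peval.
rewrite pq // mulf_neq0 ?invr_eq0 //; near: y; exact: nbhs_peval.
Unshelve. all: by end_near. Qed.

Let affine_inv (x : affine_pts) f :
  affine_reg x f -> f x != 0 -> affine_reg x (fun y => (f y)^-1).
Proof.
move=> [p [q [qx pq]]]; rewrite pq // mulf_eq0 negb_or => /andP[px _].
exists (q * q), (p * q); rewrite pevalM; split=> [|y]; first exact: mulf_neq0.
rewrite !pevalM mulf_eq0 negb_or => /andP[py qy].
by rewrite pq // invf_div -mulf_div divff ?mulr1.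
Qed.

Definition affine_space : kspace k :=
  KSpace affine_local affine_open affine_cst affine_add affine_mul
         affine_neq0 affine_inv.

End AffineSpace.

(* A locally closed subset with its reduced induced structure. *)
Section Subspace.
Context (k : fieldType) (V : kspace k) (S : set V).

Definition sub_reg (x : S) (f : S -> k) : Prop :=
  exists2 h, reg (\val x : V) h & \forall y \near x, f y = h (\val y).

Let near_val (x : S) (P : set V) :
  (\forall y \near (\val x : V), P y) -> \forall y \near x, P (\val y).
Proof. exact: (@initial_continuous S V set_val x). Qed.

Let sub_local (x : S) f g :
  (\forall y \near x, f y = g y) -> sub_reg x f -> sub_reg x g.
Proof.
by move=> fg [h hx fh]; exists h => //; apply: filterS2 fg fh => y -> ->.
Qed.

Let sub_open (x : S) f : sub_reg x f -> \forall y \near x, sub_reg y f.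
Proof.
move=> [h /reg_open/near_val hx /nbhs_interior fh].
by apply: filterS2 hx fh => y hy fhy; exists h.
Qed.

Let sub_cst (x : S) c : sub_reg x (fun=> c).
Proof. by exists (fun=> c); [exact: reg_cst|exact: (@nearW _ (nbhs x))]. Qed.

Let sub_add (x : S) f g :
  sub_reg x f -> sub_reg x g -> sub_reg x (fun y => f y + g y).
Proof.
move=> [h hx fh] [h' hx' gh']; exists (fun y => h y + h' y).
  exact: reg_add.
by apply: filterS2 fh gh' => y -> ->.
Qed.

Let sub_mul (x : S) f g :
  sub_reg x f -> sub_reg x g -> sub_reg x (fun y => f y * g y).
Proof.
move=> [h hx fh] [h' hx' gh']; exists (fun y => h y * h' y).
  exact: reg_mul.
by apply: filterS2 fh gh' => y -> ->.
Qed.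

Let sub_neq0 (x : S) f :
  sub_reg x f -> f x != 0 -> \forall y \near x, f y != 0.
Proof.
move=> [h hx fh]; rewrite (nbhs_singleton fh) => /(reg_neq0 hx)/near_val h0.
by apply: filterS2 fh h0 => y ->.
Qed.

Let sub_inv (x : S) f :
  sub_reg x f -> f x != 0 -> sub_reg x (fun y => (f y)^-1).
Proof.
move=> [h hx fh]; rewrite (nbhs_singleton fh) => hx0.
exists (fun y => (h y)^-1); first exact: reg_inv.
by apply: filterS fh => y ->.
Qed.

Definition sub_space : kspace k :=
  KSpace sub_local sub_open sub_cst sub_add sub_mul sub_neq0 sub_inv.

End Subspace.

(* The product of varieties: its topology is finer than the product topology.
   [tensor U W] consists of the functions sum_i a_i(x) b_i(y) with the a_i
   regular on U and the b_i regular on W; the sets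
   {(x, y) in U x W | h(x, y) != 0} with h in [tensor U W] form a basis of the
   topology, and the regular functions are locally quotients of such h. *)
Section Product.
Context (k : fieldType) (V W : kspace k).

Definition prod_pts : Type := (V * W)%type.
HB.instance Definition _ := Choice.on prod_pts.

Definition tensor (A : set V) (B : set W) (h : prod_pts -> k) : Prop :=
  exists (I : finType) (a : I -> V -> k) (b : I -> W -> k),
    [/\ forall i x, A x -> reg x (a i), forall i y, B y -> reg y (b i) &
        forall p, h p = \sum_(i : I) a i p.1 * b i p.2].

Lemma tensorS (A A' : set V) (B B' : set W) h :
  A' `<=` A -> B' `<=` B -> tensor A B h -> tensor A' B' h.
Proof.
move=> AA BB [I [a [b [ra rb hE]]]]; exists I, a, b.
by split=> // i x => [/AA/ra|/BB/rb].
Qed.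

Lemma tensor_cst A B c : tensor A B (fun=> c).
Proof.
exists unit, (fun _ _ => c), (fun _ _ => 1); split=> [i x _|i y _|p].
- exact: reg_cst.
- exact: reg_cst.
- by rewrite big_const cardT enumT unlock /= addr0 mulr1.
Qed.

Lemma tensor_add A B h h' :
  tensor A B h -> tensor A B h' -> tensor A B (fun p => h p + h' p).
Proof.
move=> [I [a [b [ra rb hE]]]] [J [a' [b' [ra' rb' hE']]]].
exists (I + J)%type, (fun s => match s with inl i => a i | inr j => a' j end),
  (fun s => match s with inl i => b i | inr j => b' j end).
split=> [[i|j] x Ax|[i|j] y By|p]; rewrite ?hE ?hE' ?big_sumType /=.
- exact: ra.
- exact: ra'.
- exact: rb.
- exact: rb'.
- by [].
Qed.

Lemma tensor_mul A B h h' :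
  tensor A B h -> tensor A B h' -> tensor A B (fun p => h p * h' p).
Proof.
move=> [I [a [b [ra rb hE]]]] [J [a' [b' [ra' rb' hE']]]].
exists (I * J)%type, (fun s x => a s.1 x * a' s.2 x),
  (fun s y => b s.1 y * b' s.2 y).
split=> [s x Ax|s y By|p].
- by apply: reg_mul; [exact: ra|exact: ra'].
- by apply: reg_mul; [exact: rb|exact: rb'].
rewrite hE hE' big_distrlr /= pair_big /=.
by apply: eq_bigr => s _; rewrite mulrACA.
Qed.

Definition prod_open : set_system prod_pts :=
  [set O | forall p, O p -> exists (A : set V) (B : set W) (h : prod_pts -> k),
     [/\ open A /\ A p.1, open B /\ B p.2, tensor A B h, h p != 0 &
         forall q, A q.1 -> B q.2 -> h q != 0 -> O q]].

Let prodT : prod_open setT.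
Proof.
move=> p _; exists setT, setT, (fun=> 1).
split=> //; [by split=> //; exact: openT..|exact: tensor_cst|].
exact: oner_neq0.
Qed.

Let prodI : setI_closed prod_open.
Proof.
move=> O O' oO oO' p [Op O'p].
have [A [B [h [[oA Ap] [oB Bp] th hp hO]]]] := oO p Op.
have [A' [B' [h' [[oA' Ap'] [oB' Bp'] th' hp' hO']]]] := oO' p O'p.
exists (A `&` A'), (B `&` B'), (fun q => h q * h' q); split.
- by split=> //; exact: openI.
- by split=> //; exact: openI.
- by apply: tensor_mul; [apply: tensorS th|apply: tensorS th'] => x [].
- exact: mulf_neq0.
- move=> q [Aq A'q] [Bq B'q]; rewrite mulf_eq0 negb_or => /andP[hq hq'].
  by split; [exact: hO|exact: hO'].
Qed.

Let prodU (I : Type) (f : I -> set prod_pts) :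
  (forall i, prod_open (f i)) -> prod_open (\bigcup_i f i).
Proof.
move=> oF p [i _ /oF[A [B [h [Ap Bp th hp hf]]]]].
by exists A, B, h; split=> // q Aq Bq hq; exists i => //; exact: hf.
Qed.

HB.instance Definition _ :=
  isOpenTopological.Build prod_pts prodT prodI prodU.

Lemma prod_openE (O : set prod_pts) : open O = prod_open O.
Proof. by []. Qed.

Definition prod_reg (p : prod_pts) (f : prod_pts -> k) : Prop :=
  exists (A : set V) (B : set W) (u v : prod_pts -> k),
    [/\ open A /\ A p.1, open B /\ B p.2, tensor A B u, tensor A B v &
        v p != 0 /\
        forall q, A q.1 -> B q.2 -> v q != 0 -> f q = u q / v q].

Lemma nbhs_tensor (p : prod_pts) (A : set V) (B : set W) h :
  open A -> A p.1 -> open B -> B p.2 -> tensor A B h -> h p != 0 ->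
  \forall q \near p, [/\ A q.1, B q.2 & h q != 0].
Proof.
move=> oA Ap oB Bp th hp.
rewrite /prop_near1 nbhsE; exists [set q | [/\ A q.1, B q.2 & h q != 0]] => //.
by split=> //; rewrite prod_openE => q [Aq Bq hq];
  exists A, B, h; split.
Qed.

Let prod_reg2 (p : prod_pts) f g : prod_reg p f -> prod_reg p g ->
  exists (A : set V) (B : set W) (u v u' v' : prod_pts -> k),
    [/\ open A /\ A p.1, open B /\ B p.2,
        [/\ tensor A B u, tensor A B v, tensor A B u' & tensor A B v'],
        v p != 0 /\ v' p != 0 &
        forall q, A q.1 -> B q.2 -> v q != 0 -> v' q != 0 ->
          f q = u q / v q /\ g q = u' q / v' q].
Proof.
move=> [A [B [u [v [[oA Ap] [oB Bp] tu tv [vp fE]]]]]].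
move=> [A' [B' [u' [v' [[oA' Ap'] [oB' Bp'] tu' tv' [vp' gE]]]]]].
exists (A `&` A'), (B `&` B'), u, v, u', v'; split=> //.
- by split=> //; exact: openI.
- by split=> //; exact: openI.
- by split; [apply: tensorS tu|apply: tensorS tv|apply: tensorS tu'|
             apply: tensorS tv'] => x [].
- by move=> q [? ?] [? ?] ? ?; split; [exact: fE|exact: gE].
Qed.

Let prod_local (p : prod_pts) f g :
  (\forall q \near p, f q = g q) -> prod_reg p f -> prod_reg p g.
Proof.
rewrite /prop_near1 nbhsE => -[O [] /[1!prod_openE] oO Op Ofg] [A [B [u [v [[oA Ap] [oB Bp] tu tv [vp fE]]]]]].
have [A' [B' [h [[oA' Ap'] [oB' Bp'] th hp hO]]]] := oO p Op.
exists (A `&` A'), (B `&` B'), (fun q => u q * h q), (fun q => v q * h q).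
have th' : tensor (A `&` A') (B `&` B') h by apply: tensorS th => x [].
have tu' : tensor (A `&` A') (B `&` B') u by apply: tensorS tu => x [].
have tv' : tensor (A `&` A') (B `&` B') v by apply: tensorS tv => x [].
split; [by split=> //; exact: openI..|exact: tensor_mul|exact: tensor_mul|].
split=> [|q [Aq Aq'] [Bq Bq']]; first exact: mulf_neq0.
rewrite mulf_eq0 negb_or => /andP[vq hq].
by rewrite -Ofg ?fE -?mulf_div ?divff ?mulr1 //; exact: hO.
Qed.

Let prod_reg_open (p : prod_pts) f :
  prod_reg p f -> \forall q \near p, prod_reg q f.
Proof.
move=> [A [B [u [v [[oA Ap] [oB Bp] tu tv [vp fE]]]]]].
apply: filterS (nbhs_tensor oA Ap oB Bp tv vp) => q [Aq Bq vq].
by exists A, B, u, v; split.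
Qed.

Let prod_cst (p : prod_pts) c : prod_reg p (fun=> c).
Proof.
exists setT, setT, (fun=> c), (fun=> 1); split.
- by split=> //; exact: openT.
- by split=> //; exact: openT.
- exact: tensor_cst.
- exact: tensor_cst.
- by rewrite oner_neq0 divr1.
Qed.

Let prod_add (p : prod_pts) f g :
  prod_reg p f -> prod_reg p g -> prod_reg p (fun q => f q + g q).
Proof.
move=> rf rg; have [A [B [u [v [u' [v' [oA oB [tu tv tu' tv'] [vp vp'] fgE]]]]]]]
  := prod_reg2 rf rg.
exists A, B, (fun q => u q * v' q + u' q * v q), (fun q => v q * v' q).
split=> //; [by apply: tensor_add; exact: tensor_mul|exact: tensor_mul|].
split=> [|q Aq Bq]; first exact: mulf_neq0.
rewrite mulf_eq0 negb_or => /andP[vq vq'].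
by have [-> ->] := fgE q Aq Bq vq vq'; rewrite addf_div.
Qed.

Let prod_mul (p : prod_pts) f g :
  prod_reg p f -> prod_reg p g -> prod_reg p (fun q => f q * g q).
Proof.
move=> rf rg; have [A [B [u [v [u' [v' [oA oB [tu tv tu' tv'] [vp vp'] fgE]]]]]]]
  := prod_reg2 rf rg.
exists A, B, (fun q => u q * u' q), (fun q => v q * v' q).
split=> //; [exact: tensor_mul|exact: tensor_mul|].
split=> [|q Aq Bq]; first exact: mulf_neq0.
rewrite mulf_eq0 negb_or => /andP[vq vq'].
by have [-> ->] := fgE q Aq Bq vq vq'; rewrite mulf_div.
Qed.

Let prod_neq0 (p : prod_pts) f :
  prod_reg p f -> f p != 0 -> \forall q \near p, f q != 0.
Proof.
move=> [A [B [u [v [[oA Ap] [oB Bp] tu tv [vp fE]]]]]].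
rewrite fE // mulf_eq0 negb_or => /andP[up _].
apply: filterS2 (nbhs_tensor oA Ap oB Bp tu up) (nbhs_tensor oA Ap oB Bp tv vp).
by move=> q [Aq Bq uq] [_ _ vq]; rewrite fE // mulf_neq0 // invr_eq0.
Qed.

Let prod_inv (p : prod_pts) f :
  prod_reg p f -> f p != 0 -> prod_reg p (fun q => (f q)^-1).
Proof.
move=> [A [B [u [v [[oA Ap] [oB Bp] tu tv [vp fE]]]]]].
rewrite fE // mulf_eq0 negb_or => /andP[up _].
exists A, B, (fun q => v q * v q), (fun q => u q * v q).
split=> //; [exact: tensor_mul|exact: tensor_mul|].
split=> [|q Aq Bq]; first exact: mulf_neq0.
rewrite mulf_eq0 negb_or => /andP[uq vq].
by rewrite fE // invf_div -mulf_div divff ?mulr1.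
Qed.

Definition prod_space : kspace k :=
  KSpace prod_local prod_reg_open prod_cst prod_add prod_mul
         prod_neq0 prod_inv.

End Product.

Section Varieties.
Context (k : fieldType).
Implicit Types V W : kspace k.

Definition irreducible_set (T : topologicalType) (X : set T) : Prop :=
  X !=set0 /\ forall A B : set T, closed A -> closed B ->
    X `<=` A `|` B -> X `<=` A \/ X `<=` B.

Definition affine_variety V : Prop :=
  exists n (S : set (affine_space k n)), closed S /\
    exists f : V -> sub_space S, isomorphism f.

Definition separated V : Prop :=
  closed [set p : prod_space V V | p.1 = p.2].

Definition variety V : Prop :=
  separated V /\
  exists m (U : 'I_m -> set V),
    [/\ forall i, open (U i), forall x, exists i, U i x &
        forall i, affine_variety (sub_space (U i))].

Definition irreducible_variety V : Prop :=
  variety V /\ irreducible_set [set: V].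

End Varieties.

Section RationalMaps.
Context (k : fieldType).
Implicit Types V W X : kspace k.

Definition generically V (P : V -> Prop) : Prop :=
  exists O : set V, [/\ open O, dense O & forall x, O x -> P x].

(* A rational map is represented by a morphism on a dense open set; such
   representatives are to be compared with [rat_eq], not with [=]. *)
Record ratmap V W := RatMap {
  rdom : set V;
  rfun :> V -> W;
  rdom_open : open rdom;
  rdom_dense : dense rdom;
  rfun_regular : forall x, rdom x -> regular_at x rfun
}.

Definition rat_eq V W (f g : ratmap V W) : Prop :=
  generically (fun x => [/\ rdom f x, rdom g x & f x = g x]).

(* [rat_val f x y]: x is in the (maximal) domain of definition of the rational
   map f, and y is the value of f there. *)
Definition rat_val V W (f : ratmap V W) (x : V) (y : W) : Prop :=
  exists g : ratmap V W, [/\ rat_eq g f, rdom g x & y = g x].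

Definition rat_dom V W (f : ratmap V W) : set V :=
  [set x | exists y, rat_val f x y].

Definition rat_image V W (f : ratmap V W) (X : set V) : set W :=
  [set y | exists2 x, X x & rat_val f x y].

Definition dominant V W (f : ratmap V W) : Prop :=
  dense (rat_image f [set: V]).

(* [rat_comp f g x z]: (g o f)(x) = z, both steps being defined *)
Definition rat_comp V W X (f : ratmap V W) (g : ratmap W X) (x : V) (z : X) :
  Prop := exists2 y, rat_val f x y & rat_val g y z.

Definition equivariant V W (phi : ratmap V V) (psi : ratmap W W)
    (g : ratmap V W) : Prop :=
  generically (fun x => exists2 z, rat_comp g psi x z & rat_comp phi g x z).

Definition birational V W (g : ratmap V W) : Prop :=
  exists h : ratmap W V,
    generically (fun x => rat_comp g h x x) /\
    generically (fun y => rat_comp h g y y).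

Lemma denseT (T : topologicalType) : dense [set: T].
Proof. by move=> O O0 _; rewrite setIT. Qed.

Definition rat_of_morphism V W (f : V -> W) (fm : morphism f) : ratmap V W :=
  RatMap (@openT V) (@denseT V) (fun x _ => fm x).

Definition rat_id V : ratmap V V := rat_of_morphism (@regular_at_id k V).

End RationalMaps.

Section ProductMap.
Context (k : fieldType) (V V' W W' : kspace k).
Variables (f : ratmap V V') (g : ratmap W W').

Let dom : set (prod_space V W) := [set p | rdom f p.1 /\ rdom g p.2].
Let map (p : prod_space V W) : prod_space V' W' := (f p.1, g p.2).

Let dom_open : open dom.
Proof.
rewrite prod_openE => p [fp gp]; exists (rdom f), (rdom g), (fun=> 1).
split=> //; [by split=> //; exact: rdom_open..|exact: tensor_cst|].
exact: oner_neq0.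
Qed.

Lemma reg_sum (X : kspace k) (x : X) (I : finType) (a : I -> X -> k) :
  (forall i, reg x (a i)) -> reg x (fun y => \sum_i a i y).
Proof.
move=> ra; elim: (index_enum I) => [|i s IH].
  by under eq_fun do rewrite big_nil; exact: reg_cst.
by under eq_fun do rewrite big_cons; exact: reg_add.
Qed.

Let dom_dense : dense dom.
Proof.
move=> O [p Op]; rewrite prod_openE => oO.
have [A [B [h [[oA Ap] [oB Bp] th hp hO]]]] := oO p Op.
have [I [a [b [ra rb hE]]]] := th.
have : \forall x \near p.1, h (x, p.2) != 0.
  apply: (@reg_neq0 _ _ p.1 (fun x => h (x, p.2))); last by case: (p) hp.
  have -> : (fun x => h (x, p.2)) = fun x => \sum_i a i x * b i p.2.
    by apply/funext => x; rewrite hE.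
  apply: reg_sum => i.
  by apply: reg_mul; [exact: ra|exact: reg_cst].
rewrite /prop_near1 nbhsE => -[A' [oA' Ap'] hA'].
have [x [[Ax Ax'] fx]] := @rdom_dense _ _ _ f _
  (ex_intro _ p.1 (conj Ap Ap') : A `&` A' !=set0) (openI oA oA').
have : \forall y \near p.2, h (x, y) != 0.
  apply: (@reg_neq0 _ _ p.2 (fun y => h (x, y))); last exact: hA'.
  have -> : (fun y => h (x, y)) = fun y => \sum_i a i x * b i y.
    by apply/funext => y; rewrite hE.
  apply: reg_sum => i.
  by apply: reg_mul; [exact: reg_cst|exact: rb].
rewrite /prop_near1 nbhsE => -[B' [oB' Bp'] hB'].
have [y [[By By'] gy]] := @rdom_dense _ _ _ g _
  (ex_intro _ p.2 (conj Bp Bp') : B `&` B' !=set0) (openI oB oB').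
by exists (x, y); split=> //; apply: hO => //; exact: hB'.
Qed.

Let pull_open (X Y : kspace k) (r : ratmap X Y) (A : set Y) :
  open A -> open (rdom r `&` r @^-1` A).
Proof.
move=> oA; rewrite openE => x [rx Ax]; apply: filterI.
  by apply: open_nbhs_nbhs; split=> //; exact: rdom_open.
have [cr _] := rfun_regular rx.
by apply: cr; exact: open_nbhs_nbhs.
Qed.

Let pull_tensor (A : set V') (B : set W') h : tensor A B h ->
  tensor (rdom f `&` f @^-1` A) (rdom g `&` g @^-1` B) (h \o map).
Proof.
move=> [I [a [b [ra rb hE]]]].
exists I, (fun i => a i \o f), (fun i => b i \o g); split=> [i x|i y|p].
- by move=> [/rfun_regular[_ rf] Ax]; apply: rf; exact: ra.
- by move=> [/rfun_regular[_ rg] By]; apply: rg; exact: rb.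
- by rewrite /= hE.
Qed.

Let map_regular p : dom p -> regular_at p map.
Proof.
move=> [fp gp]; split.
  move=> O; rewrite /= /prop_near1 nbhsE => -[O' [] /[1!prod_openE] oO' O'p O'O].
  have [A [B [h [[oA Ap] [oB Bp] th hp hO]]]] := oO' _ O'p.
  apply: filterS (nbhs_tensor (p := p) (pull_open f oA) (conj fp Ap)
    (pull_open g oB) (conj gp Bp) (pull_tensor th) hp).
  by move=> q [[_ Aq] [_ Bq] hq]; apply: O'O; exact: hO.
move=> h [A [B [u [v [[oA Ap] [oB Bp] tu tv [vp hE]]]]]].
exists (rdom f `&` f @^-1` A), (rdom g `&` g @^-1` B), (u \o map), (v \o map).
split; [by split=> //; exact: pull_open..|exact: pull_tensor|
  exact: pull_tensor|].
by split=> // q [_ Aq] [_ Bq]; exact: hE.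
Qed.

Definition rat_prod : ratmap (prod_space V W) (prod_space V' W') :=
  RatMap dom_open dom_dense map_regular.

End ProductMap.

Section Dynamics.
Context (k : fieldType).
Implicit Types V W Z : kspace k.

Definition rational_dynamical_system V (phi : ratmap V V) : Prop :=
  irreducible_variety V /\ dominant phi.

Definition invariant_subvariety V (phi : ratmap V V) (X : set V) : Prop :=
  [/\ irreducible_set X, closed X, X `&` rat_dom phi !=set0 &
      closure (rat_image phi X) = X].

(* rho is the rational map induced by phi on the invariant subvariety X *)
Definition restricts_to V (phi : ratmap V V) (X : set V)
    (rho : ratmap (sub_space X) (sub_space X)) : Prop :=
  generically (fun x : sub_space X =>
    exists2 y : sub_space X, rat_val rho x y & rat_val phi (\val x) (\val y)).

Definition over_base V W Z (X : set (prod_space W Z))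
    (g : ratmap (prod_space V Z) (sub_space X)) : Prop :=
  generically (fun p : prod_space V Z =>
    exists2 q : sub_space X, rat_val g p q & (\val q).2 = p.2).

Definition isotrivial V (phi : ratmap V V) : Prop :=
  exists (Z : kspace k) (psi : ratmap Z Z),
    rational_dynamical_system psi /\
    exists (l : nat) (Y : set (prod_space (affine_space k l) Z)),
      let id_psi := rat_prod (rat_id (affine_space k l)) psi in
      invariant_subvariety id_psi Y /\
      exists (rho : ratmap (sub_space Y) (sub_space Y))
             (g : ratmap (prod_space V Z) (sub_space Y)),
        [/\ restricts_to id_psi rho, birational g,
            equivariant (rat_prod phi psi) rho g & over_base g].

Record ratfun V := RatFun {
  lam_dom : set V;
  lam_fun :> V -> k;
  lam_dom_open : open lam_dom;
  lam_dom_dense : dense lam_dom;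
  lam_regular : forall x, lam_dom x -> reg x lam_fun
}.

Definition invariant_ratfun V (phi : ratmap V V) (lam : ratfun V) : Prop :=
  generically (fun x => lam_dom lam x /\
    exists y, [/\ rat_val phi x y, lam_dom lam y & lam y = lam x]).

Definition constant_ratfun V (lam : ratfun V) : Prop :=
  exists c, generically (fun x => lam_dom lam x /\ lam x = c).

End Dynamics.

(* Main.v *)
Require Import Defs.
From mathcomp Require Import all_boot all_order all_algebra.
From mathcomp Require Import boolp classical_sets functions filter.
From mathcomp Require Import topology_structure initial_topology subtype_topology.
From mathcomp Require Import mpoly closed_field.

(** Isotriviality provides a birational map g from V * Z to a subvariety Y of
    A^l * Z over Z which carries phi * psi to id * psi.  Let G be the component
    of g in A^l and h the inverse of g.  Then G(phi a, psi z) = G(a, z)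
    generically, hence
      phi^n(a) = first component of h(G(a, z), psi^n(z))
    for every n and general (a, z): the iterates of phi all belong to a single
    algebraic family of rational maps
      a |-> Theta(a, z, w) = first component of h(G(a, z), w)
    ([isotrivial_parametrization]).  Let T be the Zariski closure of the set of
    the parameters (z, w) at which this map is an iterate of phi, and let D be
    the set of the pairs (a, b) such that b = Theta(a, z, w) for some (z, w) in T.

    For every a the fibre D_a lies in the closure of the orbit of a, because a
    polynomial that vanishes on the orbit vanishes on Theta(a, z, w) for a
    dense set of parameters (z, w) of T ([orbit_closure]).  So it is enough to
    find a point a for which D_a is dense.

    On the other hand D contains the generic point of the graph of each
    iterate ([graph_in_transport_graph]), and these graphs have a dense union
    in V * V when all invariant rational functions are constant.  Indeed, let
    F(a, b) = sum_i c_i(a) u_i(b) vanish at all (a, phi^n(a)), with last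
    coefficient 1.  Its difference with F(phi^-1(a), b) has one term less and
    vanishes at the same points, so it is zero by induction.  Then F(a, b) is
    phi-invariant in a, hence independent of a, hence equal to F(b, b) = 0
    ([descent]).  Thus D is dense in V * V.

    Finally T is cut out by finitely many polynomials (Dickson's lemma gives
    [ideal_zeros_finite]), so D is a projection of a constructible set and, being
    dense, contains a nonempty open subset of V * V ([chevalley], obtained from
    quantifier elimination for k).  Any a above which this open set has a point
    has a dense fibre D_a.

    Taking T to be a closure of parameters, rather than the closure of the
    psi-orbit of a point of Z, has a reason: psi is only rational, so the forward
    psi-orbit of a given point may leave its domain. *)

Set Implicit Arguments.
Unset Strict Implicit.
Unset Printing Implicit Defensive.
Import Order.TTheory GRing.Theory.
Local Open Scope classical_set_scope.
Local Open Scope ring_scope.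

(** * Generic properties and regular functions *)
Section Generic.
Context (k : fieldType).
Implicit Types V W X : kspace k.

Lemma genericallyS V (P Q : V -> Prop) :
  (forall x, P x -> Q x) -> generically P -> generically Q.
Proof. by move=> PQ [O [oO dO OP]]; exists O; split=> // x /OP/PQ. Qed.

Lemma genericallyT V (P : V -> Prop) : (forall x, P x) -> generically P.
Proof. by move=> PT; exists setT; split=> //; [exact: openT|exact: denseT]. Qed.

Lemma genericallyI V (P Q : V -> Prop) :
  generically P -> generically Q -> generically (fun x => P x /\ Q x).
Proof.
move=> [O [oO dO OP]] [O' [oO' dO' OQ]]; exists (O `&` O'); split.
- exact: openI.
- exact: denseI.
- by move=> x [/OP ? /OQ ?].
Qed.

Lemma generically_all V (I : finType) (P : I -> V -> Prop) :
  (forall i, generically (P i)) -> generically (fun x => forall i, P i x).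
Proof.
move=> gP; suff: generically (fun x => forall i, i \in enum I -> P i x).
  by apply: genericallyS => x Px i; apply: Px; rewrite mem_enum.
elim: (enum I) => [|i s IH]; first exact: genericallyT.
apply: genericallyS (genericallyI (gP i) IH) => x [Pi Ps] j.
by rewrite inE => /orP[/eqP->//|/Ps].
Qed.

Lemma generically_meets V (P : V -> Prop) (O : set V) :
  generically P -> open O -> O !=set0 -> exists2 x, O x & P x.
Proof.
by move=> [O' [_ dO' O'P]] oO O0; have [x [Ox /O'P]] := dO' O O0 oO; exists x.
Qed.

Lemma generically_dense V (P : V -> Prop) : generically P -> dense [set x | P x].
Proof. by move=> gP O O0 oO; have [x] := generically_meets gP oO O0; exists x. Qed.

Lemma irreducible_meet (T : topologicalType) (O O' : set T) :
  irreducible_set [set: T] -> open O -> O !=set0 -> open O' -> O' !=set0 ->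
  O `&` O' !=set0.
Proof.
move=> [_ irr] oO [x Ox] oO' [y O'y]; apply: contrapT => /set0P/negP/negPn/eqP OO'.
have [|sO|sO'] := irr (~` O) (~` O') (open_closedC oO) (open_closedC oO').
- by rewrite -setCI OO' setC0.
- exact: sO x I Ox.
- exact: sO' y I O'y.
Qed.

Lemma hyperconnected_irreducible (T : topologicalType) :
  [set: T] !=set0 -> (forall O O' : set T, open O -> O !=set0 -> open O' -> O' !=set0 ->
     O `&` O' !=set0) -> irreducible_set [set: T].
Proof.
move=> T0 meet; split=> // A B cA cB AB; apply: contrapT => /not_orP[nA nB].
have ne (C : set T) : ~ [set: T] `<=` C -> ~` C !=set0.
  move=> nC; apply: contrapT => /set0P/negP/negPn/eqP C0; apply: nC.
  by rewrite -(setCK C) C0 setC0.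
have [x [nAx nBx]] := meet _ _ (closed_openC cA) (ne _ nA) (closed_openC cB) (ne _ nB).
by case: (AB x I).
Qed.

Lemma irreducible_dense (T : topologicalType) (O : set T) :
  irreducible_set [set: T] -> open O -> O !=set0 -> dense O.
Proof. by move=> irr oO O0 O' O'0 oO'; exact: irreducible_meet. Qed.

Lemma generically_near V (x : V) (P : V -> Prop) :
  irreducible_set [set: V] -> (\forall y \near x, P y) -> generically P.
Proof.
move=> irr; rewrite /prop_near1 nbhsE => -[O [oO Ox] OP].
by exists O; split=> //; apply: irreducible_dense => //; exists x.
Qed.

Lemma generically_open V (O : set V) :
  irreducible_set [set: V] -> open O -> O !=set0 -> generically O.
Proof. by move=> irr oO O0; exists O; split=> //; exact: irreducible_dense. Qed.

Lemma generically_nonempty V (P : V -> Prop) :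
  irreducible_set [set: V] -> generically P -> exists x, P x.
Proof.
by move=> [V0 _] gP; have [x _ ?] := generically_meets gP openT V0; exists x.
Qed.

Lemma nbhs_openP (T : topologicalType) (x : T) (A : set T) :
  nbhs x A -> exists2 O : set T, open O /\ O x & O `<=` A.
Proof. by rewrite nbhsE => -[O [? ?] ?]; exists O. Qed.

Lemma open_near (T : topologicalType) (O : set T) x :
  open O -> O x -> \forall y \near x, O y.
Proof. by move=> oO Ox; exact: open_nbhs_nbhs. Qed.

Lemma reg_opp V (x : V) f : reg x f -> reg x (fun y => - f y).
Proof.
move=> rf; under eq_fun do rewrite -mulN1r.
exact: (reg_mul (reg_cst x _) rf).
Qed.

Lemma reg_sub V (x : V) f g : reg x f -> reg x g -> reg x (fun y => f y - g y).
Proof. by move=> rf rg; apply: reg_add => //; exact: reg_opp. Qed.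

Lemma reg_prod V (x : V) (I : finType) (a : I -> V -> k) :
  (forall i, reg x (a i)) -> reg x (fun y => \prod_i a i y).
Proof.
move=> ra; elim: (index_enum I) => [|i s IH].
  by under eq_fun do rewrite big_nil; exact: reg_cst.
by under eq_fun do rewrite big_cons; exact: reg_mul.
Qed.

Lemma reg_exp V (x : V) f n : reg x f -> reg x (fun y => f y ^+ n).
Proof.
move=> rf; elim: n => [|n IH]; first by under eq_fun do rewrite expr0; exact: reg_cst.
by under eq_fun do rewrite exprS; exact: reg_mul.
Qed.

Lemma reg_mpoly V (x : V) n (p : {mpoly k[n]}) (f : 'I_n -> V -> k) :
  (forall i, reg x (f i)) -> reg x (fun y => p.@[fun i => f i y]).
Proof.
move=> rf; under eq_fun do rewrite mevalE.
elim: (msupp p : seq _) => [|m s IH].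
  by under eq_fun do rewrite big_nil; exact: reg_cst.
under eq_fun do rewrite big_cons; apply: reg_add => //.
apply: reg_mul; first exact: reg_cst.
by apply: reg_prod => i; exact: reg_exp.
Qed.

Lemma reg_div V (x : V) f g : reg x f -> reg x g -> g x != 0 ->
  reg x (fun y => f y / g y).
Proof. by move=> rf rg g0; apply: reg_mul => //; exact: reg_inv. Qed.

(** The set where a regular function is nonzero is open, so identities between
    regular functions pass to limit points. *)
Lemma reg_eq_closure V (x : V) f g (D : set V) : closure D x ->
  reg x f -> reg x g -> (forall y, D y -> f y = g y) -> f x = g x.
Proof.
move=> Dx rf rg fg; apply/eqP; rewrite -subr_eq0; apply/negPn/negP => fgx.
have [y [Dy]] := Dx _ (reg_neq0 (reg_sub rf rg) fgx).
by rewrite /= fg // subrr eqxx.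
Qed.

Lemma closure_nbhsI (T : topologicalType) (D O : set T) (x : T) :
  closure D x -> nbhs x O -> closure (D `&` O) x.
Proof.
move=> Dx Ox B Bx; have [y [Dy [By Oy]]] := Dx _ (filterI Bx Ox).
by exists y.
Qed.

Lemma closure_dense (T : topologicalType) (D : set T) (x : T) : dense D -> closure D x.
Proof.
move=> dD B; rewrite nbhsE => -[O [oO Ox] OB].
by have [y [Oy Dy]] := dD O (ex_intro _ x Ox) oO; exists y; split=> //; exact: OB.
Qed.

End Generic.

(** * Regular maps, separation and values of rational maps *)
Section Separation.
Context (k : fieldType).
Implicit Types V W X : kspace k.

Lemma regular_at_reg V W (f : V -> W) x h :
  regular_at x f -> reg (f x) h -> reg x (h \o f).
Proof. by move=> [_ rf] /rf. Qed.

Lemma regular_at_near V W (f : V -> W) x (P : W -> Prop) :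
  regular_at x f -> (\forall y \near f x, P y) -> \forall x' \near x, P (f x').
Proof. by move=> [cf _] /cf. Qed.

Lemma cst_regular V W (w : W) (x : V) : regular_at x (fun=> w).
Proof.
by split=> [|h _]; [exact: cvg_cst|exact: reg_cst].
Qed.

Lemma fst_regular V W (p : prod_space V W) : regular_at p (fst : prod_space V W -> V).
Proof.
split=> [A|h rh].
  move=> /nbhs_openP[O [oO Op] OA]; change (\forall q \near p, A q.1).
  apply: filterS (nbhs_tensor (p := p) oO Op openT I (tensor_cst _ _ 1) (oner_neq0 k)).
  by move=> q [/OA].
have := reg_open rh; rewrite /prop_near1 nbhsE => -[O [oO Op] Oh].
exists O, setT, (h \o fst), (fun=> 1).
split=> //; [by split=> //; exact: openT| |exact: tensor_cst|].
  exists unit, (fun=> h), (fun=> (fun=> 1)); split=> [_ x /Oh//|_ y _|q].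
    exact: reg_cst.
  by rewrite big_const cardT enumT unlock /= addr0 mulr1.
by rewrite oner_neq0; split=> // q _ _ _; rewrite divr1.
Qed.

Lemma snd_regular V W (p : prod_space V W) : regular_at p (snd : prod_space V W -> W).
Proof.
split=> [A|h rh].
  move=> /nbhs_openP[O [oO Op] OA]; change (\forall q \near p, A q.2).
  apply: filterS (nbhs_tensor (p := p) openT I oO Op (tensor_cst _ _ 1) (oner_neq0 k)).
  by move=> q [_ /OA].
have := reg_open rh; rewrite /prop_near1 nbhsE => -[O [oO Op] Oh].
exists setT, O, (h \o snd), (fun=> 1).
split=> //; [by split=> //; exact: openT| |exact: tensor_cst|].
  exists unit, (fun=> (fun=> 1)), (fun=> h); split=> [_ x _|_ y /Oh//|q].
    exact: reg_cst.
  by rewrite big_const cardT enumT unlock /= addr0 mul1r.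
by rewrite oner_neq0; split=> // q _ _ _; rewrite divr1.
Qed.

Lemma pair_regular X V W (f : X -> V) (g : X -> W) x :
  regular_at x f -> regular_at x g ->
  regular_at x ((fun y => (f y, g y)) : X -> prod_space V W).
Proof.
move=> rf rg.
have rt (A : set V) (B : set W) h : open A -> A (f x) -> open B -> B (g x) ->
    tensor A B h -> reg x (fun y => h (f y, g y)).
  move=> oA Ax oB Bx [I [a [b [ra rb hE]]]].
  under eq_fun do rewrite hE; apply: reg_sum => i; apply: reg_mul.
    by apply: (regular_at_reg rf); exact: ra.
  by apply: (regular_at_reg rg); exact: rb.
split=> [Y|h].
  rewrite /= nbhsE => -[O [] /[1!prod_openE] oO Ox OY].
  have [A [B [h [[oA Ap] [oB Bp] th hp hO]]]] := oO _ Ox.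
  have n1 := regular_at_near rf (open_near oA Ap).
  have n2 := regular_at_near rg (open_near oB Bp).
  have n3 := reg_neq0 (rt _ _ _ oA Ap oB Bp th) hp.
  apply: filterS (filterI n1 (filterI n2 n3)) => y [Ay [By hy]].
  by apply: OY; exact: hO.
move=> [A [B [u [v [[oA Ap] [oB Bp] tu tv [vp hE]]]]]].
have n1 := regular_at_near rf (open_near oA Ap).
have n2 := regular_at_near rg (open_near oB Bp).
have rv := rt _ _ _ oA Ap oB Bp tv.
have n3 := reg_neq0 rv vp.
apply: reg_local (reg_div (rt _ _ _ oA Ap oB Bp tu) rv vp).
by apply: filterS (filterI n1 (filterI n2 n3)) => y [Ay [By hy]]; rewrite /= hE.
Qed.

Lemma val_regular V (S : set V) (x : sub_space S) :
  regular_at x (\val : sub_space S -> V).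
Proof.
split; first exact: (@initial_continuous S V set_val x).
by move=> h rh; exists h => //; exact: (@nearW _ (nbhs x)).
Qed.

Lemma coord_reg n (x : affine_space k n) i :
  reg x (fun y : affine_space k n => (y : 'rV[k]_n) ord0 i).
Proof.
exists 'X_i, 1; rewrite peval1 oner_neq0; split=> // y _.
by rewrite peval1 divr1 /peval mevalXU.
Qed.

(** The form in which separation is used: with D only accumulating at x, it also
    compares maps that agree on a part of X that need not be dense. *)
Definition unique_limits W := forall X (x : X) (f g : X -> W) (D : set X),
  closure D x -> regular_at x f -> regular_at x g ->
  (forall y, D y -> f y = g y) -> f x = g x.

Lemma separated_unique_limits W : separated W -> unique_limits W.
Proof.
move=> sW X x f g D Dx rf rg fg.
apply: contrapT => nfg.
have := regular_at_near (pair_regular rf rg)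
  (@open_near (prod_space W W) _ (f x, g x) (closed_openC sW) nfg).
by move=> /Dx[y [/fg fgy nfgy]]; exact: nfgy.
Qed.

Lemma affine_unique_limits n : unique_limits (affine_space k n).
Proof.
move=> X x f g D Dx rf rg fg; apply/rowP => i.
pose c (y : affine_space k n) := (y : 'rV[k]_n) ord0 i.
apply: (reg_eq_closure (f := c \o f) (g := c \o g) Dx).
- by apply: regular_at_reg => //; exact: coord_reg.
- by apply: regular_at_reg => //; exact: coord_reg.
- by move=> y /fg /= ->.
Qed.

Lemma prod_unique_limits V W : unique_limits V -> unique_limits W ->
  unique_limits (prod_space V W).
Proof.
move=> uV uW X x f g D Dx rf rg fg.
rewrite [f x]surjective_pairing [g x]surjective_pairing.
congr pair.
  apply: (uV X x (fst \o f) (fst \o g) D) => //; last by move=> y /fg /= ->.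
  - by apply: regular_at_comp => //; exact: fst_regular.
  - by apply: regular_at_comp => //; exact: fst_regular.
apply: (uW X x (snd \o f) (snd \o g) D) => //; last by move=> y /fg /= ->.
- by apply: regular_at_comp => //; exact: snd_regular.
- by apply: regular_at_comp => //; exact: snd_regular.
Qed.

Lemma sub_unique_limits V (S : set V) : unique_limits V -> unique_limits (sub_space S).
Proof.
move=> uV X x f g D Dx rf rg fg; apply: val_inj.
apply: (uV X x (\val \o f) (\val \o g) D) => //; last by move=> y /fg /= ->.
- by apply: regular_at_comp => //; exact: val_regular.
- by apply: regular_at_comp => //; exact: val_regular.
Qed.

(** A rational map may be represented by several morphisms; separation makes its
    value at x independent of the representative. *)
Lemma rat_val_rdom V W (f : ratmap V W) x y : unique_limits W ->
  rdom f x -> rat_val f x y -> y = f x.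
Proof.
move=> uW fx [g [[O [oO dO gf]] gx ->]].
apply: (uW V x g f O); [exact: closure_dense|exact: rfun_regular..|].
by move=> z /gf[].
Qed.

Lemma rat_val_meets V W (f : ratmap V W) x y (O : set W) :
  rat_val f x y -> open O -> O y -> exists2 x', rdom f x' & O (f x').
Proof.
move=> [g [gf gx ->]] oO Oy.
have := regular_at_near (rfun_regular gx) (open_near oO Oy).
rewrite /prop_near1 nbhsE => -[O' [oO' O'x] O'O].
have [x' O'x' [_ fx' gfx']] := generically_meets gf oO' (ex_intro _ x O'x).
by exists x' => //; rewrite -gfx'; exact: O'O.
Qed.

(** Dominance expressed with one representative instead of the values
    of all representatives. *)
Definition meets_opens V W (f : ratmap V W) := forall O : set W,
  open O -> O !=set0 -> exists2 x, rdom f x & O (f x).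

Lemma dominant_meets_opens V W (f : ratmap V W) : dominant f -> meets_opens f.
Proof.
move=> df O oO O0; have [y [Oy [x _ xy]]] := df O O0 oO.
exact: rat_val_meets xy oO Oy.
Qed.

Lemma generically_preimage V W (f : ratmap V W) (P : W -> Prop) :
  irreducible_set [set: V] -> meets_opens f ->
  generically P -> generically (fun x => rdom f x /\ P (f x)).
Proof.
move=> irr mf [O [oO dO OP]]; have [[x0 _] _] := irr.
have [w [_ Ow]] := dO setT (ex_intro _ (f x0) I) openT.
have [x fx Ofx] := mf O oO (ex_intro _ w Ow).
apply: (generically_near (x := x)) => //.
apply: filterS2 (open_near (rdom_open f) fx)
  (regular_at_near (rfun_regular fx) (open_near oO Ofx)).
by move=> z fz /OP.
Qed.

End Separation.

(** * Products of irreducible spaces *)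
Section ProductIrreducible.
Context (k : fieldType) (V W : kspace k).

Lemma fst_slice (O : set (prod_space V W)) x y : open O -> O (x, y) ->
  \forall x' \near x, O (x', y).
Proof.
move=> oO Oxy.
have rp := pair_regular (regular_at_id x) (cst_regular y x).
exact: (regular_at_near rp (@open_near (prod_space V W) O (x, y) oO Oxy)).
Qed.

Lemma snd_slice (O : set (prod_space V W)) x y : open O -> O (x, y) ->
  \forall y' \near y, O (x, y').
Proof.
move=> oO Oxy.
have rp := pair_regular (cst_regular x y) (regular_at_id y).
exact: (regular_at_near rp (@open_near (prod_space V W) O (x, y) oO Oxy)).
Qed.

Lemma prod_irreducible : irreducible_set [set: V] -> irreducible_set [set: W] ->
  irreducible_set [set: prod_space V W].
Proof.
move=> irrV irrW; apply: (@hyperconnected_irreducible (prod_space V W)).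
  by have [[x _] _] := irrV; have [[y _] _] := irrW; exists (x, y).
move=> O O' oO [[x y] Oxy] oO' [[x' y'] Oxy'].
have [z [Oz Oz']] := generically_nonempty irrV (genericallyI
  (generically_near irrV (fst_slice oO Oxy))
  (generically_near irrV (fst_slice oO' Oxy'))).
have [w [Ow Ow']] := generically_nonempty irrW (genericallyI
  (generically_near irrW (snd_slice oO Oz))
  (generically_near irrW (snd_slice oO' Oz'))).
by exists (z, w).
Qed.

Lemma generically_slice (P : prod_space V W -> Prop) :
  irreducible_set [set: V] -> irreducible_set [set: W] -> generically P ->
  generically (fun y => generically (fun x => P (x, y))).
Proof.
move=> irrV irrW gP.
have [[x0 y0] _] := generically_nonempty (prod_irreducible irrV irrW) gP.
have [O [oO dO OP]] := gP.
have [[x y] [_ Oxy]] := dO setT (ex_intro _ (x0, y0) I) openT.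
apply: genericallyS (generically_near irrW (snd_slice oO Oxy)) => y' Oxy'.
by apply: genericallyS (generically_near irrV (fst_slice oO Oxy')) => x' /OP.
Qed.

End ProductIrreducible.

(** * Affine charts *)
Section Charts.
Context (k : fieldType).
Implicit Types V W X : kspace k.

Lemma affine_nbhsP n (x : affine_space k n) (A : set (affine_space k n)) : nbhs x A <->
  exists2 p, peval p x != 0 & forall y, peval p y != 0 -> A y.
Proof.
split=> [/nbhs_openP[O [oO Ox] OA]|[p px pA]].
  by have [p px pO] := oO x Ox; exists p => // y /pO/OA.
exact: filterS pA (nbhs_peval px).
Qed.

Lemma peval_reg n (x : affine_space k n) (p : {mpoly k[n]}) : reg x (peval p).
Proof. by apply: reg_mpoly => i; exact: coord_reg. Qed.

Lemma affine_regular V n (f : V -> affine_space k n) v :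
  (forall i, reg v (fun w => (f w : 'rV[k]_n) ord0 i)) -> regular_at v f.
Proof.
move=> rf; have rp p : reg v (fun w => peval p (f w)) by exact: reg_mpoly.
split=> [A /affine_nbhsP[p px pA]|h [p [q [qx pq]]]].
  change (\forall w \near v, A (f w)).
  exact: filterS (fun w => pA (f w)) (reg_neq0 (rp p) px).
apply: reg_local (reg_div (rp p) (rp q) qx).
by apply: filterS (reg_neq0 (rp q) qx) => w qw; rewrite /= pq.
Qed.

Lemma coord_regular_at V n (f : V -> affine_space k n) v i :
  regular_at v f -> reg v (fun w => (f w : 'rV[k]_n) ord0 i).
Proof. by move=> rf; exact: (regular_at_reg rf (coord_reg (f v) i)). Qed.

(** An injective system of coordinates on V0.  The last two fields say that the
    topology and the germs of regular functions on V0 come from affine space.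
    They speak of points w with x w = y, so that x can be a total function and
    no inverse has to be chosen.  The image may fail to be closed, which makes
    the notion stable under restriction to arbitrary subsets and products. *)
Record chart V (V0 : set V) n (x : V -> affine_space k n) : Prop := Chart {
  chart_open : open V0;
  chart_regular : forall v, V0 v -> regular_at v x;
  chart_inj : forall v w, V0 v -> V0 w -> x v = x w -> v = w;
  chart_nbhs : forall v (A : set V), V0 v -> nbhs v A ->
    \forall y \near x v, forall w, V0 w -> x w = y -> A w;
  chart_reg : forall v f, V0 v -> reg v f ->
    exists2 g, reg (x v) g & \forall y \near x v, forall w, V0 w -> x w = y -> f w = g y
}.

Lemma chart_affine n : chart [set: affine_space k n] (@id (affine_space k n)).
Proof.
split=> [|v _|//|v A _ Av|v f _ rf]; first exact: openT.
- exact: regular_at_id.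
- by apply: filterS Av => y Ay w _ ->.
- by exists f => //; apply: (@filterE _ (nbhs v)) => y w _ ->.
Qed.

Lemma sub_nbhs V (S : set V) (v : sub_space S) (A : set (sub_space S)) :
  nbhs v A -> \forall w \near (\val v : V), forall s : sub_space S, \val s = w -> A s.
Proof.
move=> /nbhs_openP[O [[B oB <-] Bv] OA].
apply: filterS (open_near oB Bv) => w Bw s sw; apply: OA.
by change (B (\val s)); rewrite sw.
Qed.

Lemma chart_sub V (V0 : set V) n (x : V -> affine_space k n) (S : set V) : chart V0 x ->
  chart ((\val : sub_space S -> V) @^-1` V0) (x \o (\val : sub_space S -> V)).
Proof.
move=> cx; split.
- by exists V0 => //; exact: chart_open cx.
- move=> v V0v; apply: regular_at_comp; first exact: val_regular.
  exact: (chart_regular cx).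
- by move=> v w V0v V0w /(chart_inj cx V0v V0w)/val_inj.
- move=> v A V0v /sub_nbhs/(chart_nbhs cx V0v).
  by apply: filterS => y yA w V0w xw; apply: (yA (\val w)).
- move=> v f V0v [h rh /sub_nbhs/(chart_nbhs cx V0v) fh].
  have [g rg hg] := chart_reg cx V0v rh; exists g => //.
  apply: filterS2 fh hg => y fhy hgy w V0w xw.
  by rewrite (fhy (\val w) V0w xw w erefl); exact: hgy.
Qed.

Lemma lsubmx_regular m n (x : affine_space k (m + n)) :
  regular_at x (lsubmx : affine_space k (m + n) -> affine_space k m).
Proof.
by apply: affine_regular => i; under eq_fun do rewrite mxE; exact: coord_reg.
Qed.

Lemma rsubmx_regular m n (x : affine_space k (m + n)) :
  regular_at x (rsubmx : affine_space k (m + n) -> affine_space k n).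
Proof.
by apply: affine_regular => i; under eq_fun do rewrite mxE; exact: coord_reg.
Qed.

Lemma row_mx_regular V m n (f : V -> affine_space k m) (g : V -> affine_space k n) v :
  regular_at v f -> regular_at v g ->
  regular_at v ((fun w => row_mx (f w) (g w)) : V -> affine_space k (m + n)).
Proof.
move=> rf rg; apply: affine_regular => i.
under eq_fun do rewrite mxE; case: (fintype.split i) => j; exact: coord_regular_at.
Qed.

Definition prod_chart V W m n (x : V -> affine_space k m) (t : W -> affine_space k n)
  (p : prod_space V W) : affine_space k (m + n) := row_mx (x p.1) (t p.2).

Lemma chart_prod V W (V0 : set V) (W0 : set W) m n
    (x : V -> affine_space k m) (t : W -> affine_space k n) :
  chart V0 x -> chart W0 t ->
  chart ([set p | V0 p.1 /\ W0 p.2] : set (prod_space V W)) (prod_chart x t).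
Proof.
move=> cx ct.
pose l (y : affine_space k (m + n)) : affine_space k m := lsubmx y.
pose r (y : affine_space k (m + n)) : affine_space k n := rsubmx y.
have lE p : l (prod_chart x t p) = x p.1 by exact: row_mxKl.
have rE p : r (prod_chart x t p) = t p.2 by exact: row_mxKr.
have rl p : regular_at (prod_chart x t p) l := lsubmx_regular _.
have rr p : regular_at (prod_chart x t p) r := rsubmx_regular _.
have near_l p (P : set (affine_space k m)) : (\forall y \near x p.1, P y) ->
    \forall y \near prod_chart x t p, P (l y).
  by move=> nP; apply: (regular_at_near (rl p)); rewrite lE.
have near_r p (P : set (affine_space k n)) : (\forall y \near t p.2, P y) ->
    \forall y \near prod_chart x t p, P (r y).
  by move=> nP; apply: (regular_at_near (rr p)); rewrite rE.
(* Being the pullback of a regular function is stable under sums, products and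
   quotients, so that only the tensors have to be treated. *)
pose loc (p : prod_space V W) f := exists2 g, reg (prod_chart x t p) g &
  \forall y \near prod_chart x t p, forall q, V0 q.1 /\ W0 q.2 ->
    prod_chart x t q = y -> f q = g y.
have loc_tensor (p : prod_space V W) A B h : V0 p.1 -> W0 p.2 -> A p.1 -> B p.2 ->
    tensor A B h -> loc p h.
  move=> V0p W0p Ap Bp [J [a [b [ra rb hE]]]].
  have /choice[ga gaP] : forall i, exists g, reg (x p.1) g /\
      \forall y \near x p.1, forall w, V0 w -> x w = y -> a i w = g y.
    by move=> i; have [g ? ?] := chart_reg cx V0p (ra i _ Ap); exists g.
  have /choice[gb gbP] : forall i, exists g, reg (t p.2) g /\
      \forall y \near t p.2, forall w, W0 w -> t w = y -> b i w = g y.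
    by move=> i; have [g ? ?] := chart_reg ct W0p (rb i _ Bp); exists g.
  exists (fun y => \sum_i ga i (l y) * gb i (r y)).
    apply: reg_sum => i; apply: reg_mul.
      by apply: (regular_at_reg (rl p)); rewrite lE; exact: (gaP i).1.
    by apply: (regular_at_reg (rr p)); rewrite rE; exact: (gbP i).1.
  have fp := nbhs_filter (prod_chart x t p).
  have na := filter_forall fp (fun i => near_l _ _ (gaP i).2).
  have nb := filter_forall fp (fun i => near_r _ _ (gbP i).2).
  apply: filterS2 na nb => y ya yb q [V0q W0q] qy.
  rewrite hE; apply: eq_bigr => i _; congr (_ * _).
    by apply: ya => //; rewrite -qy lE.
  by apply: yb => //; rewrite -qy rE.
split.
- move=> p [V0p W0p]; exists V0, W0, (fun=> 1); split=> //.
  + by split=> //; exact: chart_open cx.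
  + by split=> //; exact: chart_open ct.
  + exact: tensor_cst.
  + exact: oner_neq0.
- move=> p [V0p W0p]; apply: row_mx_regular.
    exact: (regular_at_comp (fst_regular p) (chart_regular cx V0p)).
  exact: (regular_at_comp (snd_regular p) (chart_regular ct W0p)).
- move=> [v w] [v' w'] [/= V0v W0w] [/= V0v' W0w'] /eq_row_mx[/= xx tt].
  by rewrite (chart_inj cx V0v V0v' xx) (chart_inj ct W0w W0w' tt).
- move=> p O [V0p W0p] /nbhs_openP[O' [oO' O'p] O'O].
  have [A [B [h [[oA Ap] [oB Bp] th hp hO]]]] := oO' _ O'p.
  have [g rg hg] := loc_tensor p A B h V0p W0p Ap Bp th.
  have gp : g (prod_chart x t p) != 0.
    by rewrite -(nbhs_singleton hg p).
  have nA := near_l _ _ (chart_nbhs cx V0p (open_near oA Ap)).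
  have nB := near_r _ _ (chart_nbhs ct W0p (open_near oB Bp)).
  apply: filterS (filterI (filterI hg (reg_neq0 rg gp)) (filterI nA nB)).
  move=> y [[hy gy] [Ay By]] q [V0q W0q] qy; apply: O'O; apply: hO.
  + by apply: Ay => //; rewrite -qy lE.
  + by apply: By => //; rewrite -qy rE.
  + by rewrite (hy q).
- move=> p f [V0p W0p] [A [B [u [v [[oA Ap] [oB Bp] tu tv [vp fE]]]]]].
  have [g rg ug] := loc_tensor p A B u V0p W0p Ap Bp tu.
  have [h rh vh] := loc_tensor p A B v V0p W0p Ap Bp tv.
  have hp : h (prod_chart x t p) != 0 by rewrite -(nbhs_singleton vh p).
  exists (fun y => g y / h y); first exact: reg_div.
  have nA := near_l _ _ (chart_nbhs cx V0p (open_near oA Ap)).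
  have nB := near_r _ _ (chart_nbhs ct W0p (open_near oB Bp)).
  apply: filterS (filterI (filterI (filterI ug vh) (reg_neq0 rh hp)) (filterI nA nB)).
  move=> y [[[uy vy] hy] [Ay By]] q [V0q W0q] qy.
  rewrite fE ?(uy q) ?(vy q) //.
  + by apply: Ay => //; rewrite -qy lE.
  + by apply: By => //; rewrite -qy rE.
Qed.

(** Needed because the chart of a variety is given on the subspace V0, whereas
    regularity of its extension to V is a statement about V. *)
Lemma open_sub_regular V W (V0 : set V) (F : V -> W) (v : sub_space V0) : open V0 ->
  regular_at v (F \o (\val : sub_space V0 -> V)) -> regular_at (\val v : V) F.
Proof.
move=> oV0 [cF rF].
have down (P : V -> Prop) : (\forall s \near v, P (\val s)) ->
    \forall w \near (\val v : V), P w.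
  move=> /sub_nbhs nP.
  have V0v : V0 (\val v) by exact: set_valP.
  apply: filterS2 nP (open_near oV0 V0v) => w wP V0w.
  exact: (wP (exist _ w (mem_set V0w)) erefl).
split=> [A FA|h /rF[h' rh' hh']]; first exact: (down (fun w => A (F w)) (cF A FA)).
by apply: reg_local rh'; apply: down; apply: filterS hh' => s /= ->.
Qed.

Lemma affine_chart V (V0 : set V) : open V0 -> affine_variety (sub_space V0) ->
  exists n (x : V -> affine_space k n), chart V0 x /\ closed [set x v | v in V0].
Proof.
move=> oV0 [n [S [cS [f [fm [g [gm fK gK]]]]]]].
have V0P (v : sub_space V0) : V0 (\val v) by exact: set_valP.
have SP (s : sub_space S) : S (\val s) by exact: set_valP.
pose up v (V0v : V0 v) : sub_space V0 := exist _ v (mem_set V0v).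
have valK (v : sub_space V0) (V0v : V0 (\val v)) : up _ V0v = v by exact: val_inj.
pose x (v : V) : affine_space k n :=
  match pselect (V0 v) with left V0v => \val (f (up v V0v)) | right _ => 0 end.
have xE (v : sub_space V0) : x (\val v) = \val (f v).
  rewrite /x; case: pselect => [V0v|nV0v]; first by rewrite valK.
  by case: nV0v.
have lift (v : V) : V0 v -> exists v' : sub_space V0, \val v' = v :> V.
  by move=> V0v; exists (up v V0v).
have near_x (v : sub_space V0) (P : sub_space S -> Prop) : (\forall s \near f v, P s) ->
    \forall y \near x (\val v), forall s : sub_space S, \val s = y -> P s.
  by rewrite xE; exact: sub_nbhs.
exists n, x; split; last first.
  suff -> : [set x v | v in V0] = S by [].
  apply/seteqP; split=> [_ [v /lift[v' <-] <-]|s Ss]; first by rewrite xE.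
  exists (\val (g (exist _ s (mem_set Ss)))) => //.
  by rewrite xE gK.
split=> //.
- move=> _ /lift[v <-]; apply: open_sub_regular => //.
  have -> : x \o (\val : sub_space V0 -> V) = \val \o f by apply/funext => w; exact: xE.
  by apply: regular_at_comp; [exact: fm|exact: val_regular].
- move=> _ _ /lift[v <-] /lift[w <-]; rewrite !xE => /val_inj fvw.
  by rewrite -(fK v) fvw fK.
- move=> _ A /lift[v <-] vA.
  have ng : \forall s \near f v, A (\val (g s)).
    apply: (regular_at_near (f := \val \o g) (W := V)).
      by apply: regular_at_comp; [exact: gm|exact: val_regular].
    by rewrite /= fK.
  apply: filterS (near_x _ _ ng) => y yA _ /lift[w <-] xw.
  by rewrite -(fK w); apply: yA; rewrite -xw xE.
- move=> _ h /lift[v <-] rh.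
  have [G rG hG] : sub_reg (f v) (h \o (\val \o g)).
    have := regular_at_comp (gm (f v)) (val_regular (g (f v))) => -[_]; apply.
    by rewrite /= fK.
  exists G; first by rewrite xE.
  apply: filterS (near_x _ _ hG) => y yG _ /lift[w <-] xw.
  by rewrite -[in LHS](fK w) -xw xE; apply: yG; rewrite -xw xE.
Qed.

Lemma variety_chart V : irreducible_variety V ->
  exists (V0 : set V) n (x : V -> affine_space k n),
    [/\ chart V0 x, V0 !=set0 & closed [set x v | v in V0]].
Proof.
move=> [[_ [m [U [oU covU affU]]]] [[v _] _]].
have [i Uv] := covU v; have [n [x [cx clx]]] := affine_chart (oU i) (affU i).
by exists (U i), n, x; split=> //; exists v.
Qed.

(** In an irreducible space one local expression is a generic expression. *)
Lemma chart_quotient V (V0 : set V) n (x : V -> affine_space k n) v f :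
  irreducible_set [set: V] -> chart V0 x -> V0 v -> reg v f ->
  exists p q, generically (fun w => [/\ V0 w, peval q (x w) != 0 &
    f w = peval p (x w) / peval q (x w)]).
Proof.
move=> irr cx V0v rf; have [g [p [q [qx gE]]] fg] := chart_reg cx V0v rf.
exists p, q.
have n1 := regular_at_near (chart_regular cx V0v) fg.
have n2 := regular_at_near (chart_regular cx V0v) (nbhs_peval qx).
have n3 := open_near (chart_open cx) V0v.
apply: generically_near irr (filterS _ (filterI (filterI n1 n2) n3)).
by move=> w [[fw qw] V0w]; split=> //; rewrite (fw w V0w erefl) gE.
Qed.

End Charts.

(** * Finiteness of systems of polynomial equations *)
Section Noetherian.
Local Open Scope nat_scope.

(** Induction on the number of functions: outside the part of M dominated by
    the elements found for the remaining ones, f takes finitely many values,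
    and each level set of f is handled by induction again.  The functions are
    listed, with default value 0, to avoid a dependent index in the induction. *)
Lemma dickson (T : eqType) (l : seq (T -> nat)) (M : T -> Prop) :
  exists2 s : seq T, (forall t, t \in s -> M t) &
    forall t, M t -> exists2 t', t' \in s &
      forall i, nth (fun=> 0) l i t' <= nth (fun=> 0) l i t.
Proof.
elim: l M => [|f l IH] M.
  have [[t Mt]|M0] := pselect (exists t, M t); last first.
    by exists [::] => // t Mt; case: M0; exists t.
  exists [:: t] => [t'|t' _]; first by rewrite inE => /eqP->.
  by exists t; rewrite ?mem_head // => i; rewrite nth_nil.
have [s sM sP] := IH M.
have lvl N : exists2 s' : seq T, (forall t, t \in s' -> M t) &
    forall t, M t -> f t < N -> exists2 t', t' \in s' &
      forall i, (nth (fun=> 0) (f :: l) i) t' <= (nth (fun=> 0) (f :: l) i) t.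
  elim: N => [|N [s1 s1M s1P]]; first by exists [::].
  have [s2 s2M s2P] := IH (fun t => M t /\ f t = N).
  exists (s1 ++ s2) => [t|t Mt].
    by rewrite mem_cat => /orP[/s1M//|/s2M[]].
  rewrite ltnS leq_eqVlt => /orP[/eqP ftN|ftN].
    have [t' t's2 t't] := s2P t (conj Mt ftN).
    exists t'; first by rewrite mem_cat t's2 orbT.
    by case=> [|i] /=; rewrite ?ftN; [have [_ ->] := s2M _ t's2|exact: t't].
  have [t' t's1 t't] := s1P t Mt ftN.
  by exists t' => //; rewrite mem_cat t's1.
have [s' s'M s'P] := lvl (\max_(t <- s) f t).
exists (s ++ s') => [t|t Mt]; first by rewrite mem_cat => /orP[/sM|/s'M].
have [lt|ge] := ltnP (f t) (\max_(t <- s) f t).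
  have [t' t's' ?] := s'P t Mt lt; exists t' => //.
  by rewrite mem_cat t's' orbT.
have [t' t's t't] := sP t Mt; exists t'; first by rewrite mem_cat t's.
case=> [|i] /=; last exact: t't.
by apply: leq_trans ge; rewrite (big_rem t') //= leq_maxl.
Qed.

Local Open Scope ring_scope.
Variables (k : fieldType) (n : nat).

(** The argument of Groebner bases: an element of J whose leading monomial is a
    multiple of one from the finite list can be reduced to a smaller one. *)
Lemma ideal_zeros_finite (J : {mpoly k[n]} -> Prop) :
  (forall p q c m, J p -> J q -> J (p - c *: 'X_[m] * q)) ->
  exists2 s : seq {mpoly k[n]}, (forall p, p \in s -> J p) &
    forall v, (forall p, p \in s -> p.@[v] = 0) -> forall p, J p -> p.@[v] = 0.
Proof.
move=> Jsub.
have [s sJ sP] := dickson (map (fun i (p : {mpoly k[n]}) => mlead p i) (enum 'I_n))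
  (fun p => J p /\ p != 0).
exists s => [p /sJ[]//|v sv p]; elim/mleadrect: p => p IH Jp.
have [->|p0] := eqVneq p 0; first by rewrite meval0.
have [q qs qp] := sP p (conj Jp p0); have [Jq q0] := sJ q qs.
have qlp : (mlead q <= mlead p)%MM.
  apply/mnm_lepP => i; have := qp i.
  by rewrite !(nth_map i) -?enumT ?size_enum_ord // nth_ord_enum.
pose c := mleadc p / mleadc q; pose r := p - c *: 'X_[mlead p - mlead q] * q.
have c0 : c != 0 by rewrite mulf_neq0 ?invr_eq0 ?mleadc_eq0.
have rv : r.@[v] = p.@[v] by rewrite mevalB mevalM (sv q qs) mulr0 subr0.
rewrite -rv; have [->|r0] := eqVneq r 0; first by rewrite meval0.
apply: IH; last exact: Jsub.
have X0 : 'X_[mlead p - mlead q] != 0 :> {mpoly k[n]}.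
  by rewrite -msupp_eq0 msuppX.
have lX : mlead (c *: 'X_[mlead p - mlead q] * q) = mlead p.
  by rewrite -scalerAl mleadZ // mleadM // mleadXm submK.
have lrp : (mlead r <= mlead p)%O.
  by apply: (le_trans (mleadB_le _ _)); rewrite lX joinxx.
rewrite lt_neqAle lrp andbT; apply/eqP => lr.
have := mleadc_eq0 r; rewrite (negbTE r0) lr => /negP; apply.
rewrite mcoeffB -scalerAl mcoeffZ mulrC -{2}(submK qlp) mulrC.
rewrite [_ * q]mulrC [(_ - _ + _)%MM]addmC addmC mcoeffMX.
by rewrite divfK ?mleadc_eq0 // subrr.
Qed.

End Noetherian.

(** * Projections of constructible sets *)
Section Chevalley.
Context (k : closedFieldType).

Definition coord_seq n (v : 'rV[k]_n) : seq k := [seq v ord0 i | i <- enum 'I_n].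

Lemma nth_coord_seq n (v : 'rV[k]_n) (i : 'I_n) : (coord_seq v)`_i = v ord0 i.
Proof. by rewrite (nth_map i) ?size_enum_ord // nth_ord_enum. Qed.

Lemma size_coord_seq n (v : 'rV[k]_n) : size (coord_seq v) = n.
Proof. by rewrite size_map size_enum_ord. Qed.

Definition mpoly_term n (p : {mpoly k[n]}) : GRing.term k :=
  foldr (fun m t => GRing.Add (GRing.Mul (GRing.Const p@_m)
     (foldr (fun i u => GRing.Mul (GRing.Exp (GRing.Var k (i : 'I_n)) (m i)) u)
        (GRing.Const 1) (index_enum 'I_n))) t)
    (GRing.Const 0) (msupp p).

Lemma rterm_mpoly_term n (p : {mpoly k[n]}) : GRing.rterm (mpoly_term p).
Proof.
rewrite /mpoly_term; elim: (msupp p : seq _) => //= m s ->; rewrite andbT.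
by elim: (index_enum _).
Qed.

Lemma eval_mpoly_term n (p : {mpoly k[n]}) e :
  GRing.eval e (mpoly_term p) = p.@[fun i => e`_i].
Proof.
rewrite mevalE /mpoly_term; elim: (msupp p : seq _) => [|m s IH] /=.
  by rewrite big_nil.
rewrite big_cons IH; congr (_ * _ + _).
by elim: (index_enum _) => [|i r IHr] /=; rewrite ?big_nil ?big_cons ?IHr.
Qed.

(** Inverses and variables of index at least n go to 0: the terms that come out
    of quantifier elimination are free of inverses, and the other variables
    are evaluated to the default value of a sequence of length n. *)
Fixpoint term_mpoly n (t : GRing.term k) : {mpoly k[n]} :=
  match t with
  | GRing.Var i => if insub i is Some j then 'X_j else 0
  | GRing.Const c => c%:MP
  | GRing.NatConst m => m%:R
  | GRing.Add t1 t2 => term_mpoly n t1 + term_mpoly n t2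
  | GRing.Opp t1 => - term_mpoly n t1
  | GRing.NatMul t1 m => term_mpoly n t1 *+ m
  | GRing.Mul t1 t2 => term_mpoly n t1 * term_mpoly n t2
  | GRing.Inv _ => 0
  | GRing.Exp t1 m => term_mpoly n t1 ^+ m
  end.

Lemma eval_term_mpoly n (t : GRing.term k) (v : 'rV[k]_n) : GRing.rterm t ->
  GRing.eval (coord_seq v) t = peval (term_mpoly n t) v.
Proof.
rewrite /peval; elim: t => //=.
- move=> i _; case: insubP => [j _ <-|]; first by rewrite mevalXU nth_coord_seq.
  by rewrite -leqNgt => le; rewrite nth_default ?size_coord_seq // meval0.
- by move=> c _; rewrite mevalC.
- by move=> m _; rewrite mevalMn meval1.
- by move=> t1 IH1 t2 IH2 /andP[/IH1-> /IH2->]; rewrite mevalD.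
- by move=> t1 IH1 /IH1->; rewrite mevalN.
- by move=> t1 IH1 m /IH1->; rewrite mevalMn.
- by move=> t1 IH1 t2 IH2 /andP[/IH1-> /IH2->]; rewrite mevalM.
- by move=> t1 IH1 m /IH1->; rewrite rmorphXn.
Qed.

Definition projection m e (ps : seq {mpoly k[m + e]}) (q : {mpoly k[m + e]})
    : set (affine_pts k m) :=
  [set v | exists w : 'rV[k]_e,
     (forall p, p \in ps -> peval p (row_mx (v : 'rV[k]_m) w) = 0) /\
     peval q (row_mx (v : 'rV[k]_m) w) != 0].

Definition constructible_formula n (ps : seq {mpoly k[n]}) (q : {mpoly k[n]}) :=
  GRing.And
    (foldr (fun p => GRing.And (GRing.Equal (mpoly_term p) (GRing.Const 0)))
       (GRing.Bool true) ps)
    (GRing.Not (GRing.Equal (mpoly_term q) (GRing.Const 0))).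

Definition projection_formula m e (ps : seq {mpoly k[m + e]}) (q : {mpoly k[m + e]}) :=
  foldr GRing.Exists (constructible_formula ps q) (iota m e).

Lemma projection_rformula m e (ps : seq {mpoly k[m + e]}) q :
  GRing.rformula (projection_formula ps q).
Proof.
rewrite /projection_formula; elim: (iota m e) => //=.
rewrite rterm_mpoly_term /= andbT.
by elim: ps => //= p ps ->; rewrite rterm_mpoly_term.
Qed.

Lemma constructible_formulaP n (ps : seq {mpoly k[n]}) q (v : 'rV[k]_n) e :
  (forall i : 'I_n, e`_i = v ord0 i) ->
  GRing.holds e (constructible_formula ps q) <->
  (forall p, p \in ps -> peval p v = 0) /\ peval q v != 0.
Proof.
move=> eE /=.
have evE p : GRing.eval e (mpoly_term p) = peval p v.
  by rewrite eval_mpoly_term; exact: meval_eq.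
rewrite evE; have -> : (~ peval q v = 0) <-> peval q v != 0 by split=> /eqP.
suff -> : GRing.holds e (foldr (fun p =>
    GRing.And (GRing.Equal (mpoly_term p) (GRing.Const 0))) (GRing.Bool true) ps) <->
  (forall p, p \in ps -> peval p v = 0) by [].
elim: ps => [|p ps IH] //=; rewrite evE IH; split=> [[p0 ps0] p'|ps0].
  by rewrite inE => /orP[/eqP->|/ps0].
by split=> [|p' p'ps]; apply: ps0; rewrite inE ?eqxx ?p'ps ?orbT.
Qed.

Lemma projection_formulaP m e (ps : seq {mpoly k[m + e]}) q (v : 'rV[k]_m) :
  GRing.holds (coord_seq v) (projection_formula ps q) <-> projection ps q v.
Proof.
split=> [/(GRing.foldExistsP _ _ _)[e' ee' he']|[w vw]].
  pose w : 'rV[k]_e := \row_j e'`_(m + j); exists w.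
  apply/(constructible_formulaP _ _ (e := e')) => // i.
  rewrite mxE; case: splitP => j ->; rewrite ?mxE //.
  by rewrite -(ee' j) ?nth_coord_seq // !inE mem_iota; rewrite leqNgt ltn_ord.
apply/GRing.foldExistsP; exists (coord_seq (row_mx v w)).
  move=> i; rewrite !inE mem_iota negb_and -leqNgt -ltnNge => /orP[lt_im|le].
    rewrite (nth_coord_seq v (Ordinal lt_im)).
    by rewrite (nth_coord_seq _ (lshift e (Ordinal lt_im))) row_mxEl.
  by rewrite !nth_default ?size_coord_seq // (leq_trans _ le) // leq_addr.
by apply/(constructible_formulaP ps q (v := row_mx v w)) => // i; rewrite nth_coord_seq.
Qed.

Lemma qf_eval_dnf (e : seq k) bcs :
  GRing.qf_eval e (GRing.dnf_to_form bcs) =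
  has (fun bc => all (fun t => GRing.eval e t == 0) bc.1 &&
                 all (fun t => GRing.eval e t != 0) bc.2) bcs.
Proof.
elim: bcs => //= [[b1 b2] bcs <-] /=; congr (_ && _ || _).
  by elim: b1 => //= t b1 ->.
by elim: b2 => //= t b2 ->.
Qed.

(** Quantifier elimination for an algebraically closed field, followed by the
    disjunctive normal form. *)
Lemma projection_dnf m e (ps : seq {mpoly k[m + e]}) q :
  exists bcs : seq (seq {mpoly k[m]} * seq {mpoly k[m]}), forall v : affine_pts k m,
    projection ps q v <-> exists2 bc, bc \in bcs &
      (forall p, p \in bc.1 -> peval p v = 0) /\ (forall p, p \in bc.2 -> peval p v != 0).
Proof.
pose proj := @ClosedFieldQE.ex_elim k.
have wf : GRing.wf_QE_proj proj by exact: ClosedFieldQE.wf_ex_elim.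
have ok : GRing.valid_QE_proj proj.
  by apply: ClosedFieldQE.holds_ex_elim; exact: (@solve_monicpoly k).
pose f := projection_formula ps q.
have rf : GRing.rformula f := projection_rformula ps q.
pose g := GRing.quantifier_elim proj f.
have /andP[qg rg] : GRing.qf_form g && GRing.rformula g.
  exact: GRing.quantifier_elim_wf.
pose bcs := GRing.qf_to_dnf g false.
have rbcs : all (@GRing.dnf_rterm k) bcs by exact: GRing.qf_to_dnf_rterm.
exists [seq (map (term_mpoly m) bc.1, map (term_mpoly m) bc.2) | bc <- bcs] => v.
rewrite -projection_formulaP -/f.
have -> : GRing.holds (coord_seq v) f <->
    GRing.qf_eval (coord_seq v) (GRing.dnf_to_form bcs).
  rewrite GRing.qf_to_dnfP ?qg ?rg //.
  by split=> /(GRing.quantifier_elim_rformP wf ok _ rf).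
rewrite qf_eval_dnf.
elim: bcs rbcs => [_|[b1 b2] bcs IH /= /andP[/andP[/= rb1 rb2] rbcs]].
  by split=> //= -[].
have eq_all (b : seq (GRing.term k)) (a : pred k) : all (@GRing.rterm k) b ->
    all (fun t => a (GRing.eval (coord_seq v) t)) b =
    all (fun p => a (peval p v)) (map (term_mpoly m) b).
  by elim: b => //= t b IHb /andP[rt rb]; rewrite IHb // eval_term_mpoly.
rewrite (eq_all b1 (fun x => x == 0)) // (eq_all b2 (fun x => x != 0)) //.
split.
  case/orP=> [/andP[/allP h1 /allP h2]|/(IH rbcs)[bc bcin hbc]].
    exists (map (term_mpoly m) b1, map (term_mpoly m) b2); first exact: mem_head.
    by split=> p; [move=> /h1/eqP|move=> /h2].
  by exists bc => //; rewrite inE bcin orbT.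
case=> bc; rewrite inE => /orP[/eqP-> /= [h1 h2]|bcin hbc]; apply/orP; [left|right].
  by apply/andP; split; apply/allP => p; [move/h1/eqP|move/h2].
by apply/(IH rbcs); exists bc.
Qed.

(** The first two hypotheses are irreducibility of X and density of the
    projection in X.  A clause of the disjunctive normal form whose equations
    all hold on X must then be satisfied somewhere on X, and its inequations
    define the open set. *)
Lemma chevalley m e (ps : seq {mpoly k[m + e]}) (q : {mpoly k[m + e]})
    (X : set (affine_pts k m)) :
  (forall f g, (forall x, X x -> peval f x * peval g x = 0) ->
     (forall x, X x -> peval f x = 0) \/ (forall x, X x -> peval g x = 0)) ->
  (forall f, (forall x, X x -> projection ps q x -> peval f x = 0) ->
     forall x, X x -> peval f x = 0) ->
  X !=set0 ->
  exists f, (exists2 x, X x & peval f x != 0) /\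
    forall x, X x -> peval f x != 0 -> projection ps q x.
Proof.
move=> Xirr Xdense X0; have [bcs bcsP] := projection_dnf ps q.
have prodN (s : seq {mpoly k[m]}) :
    (forall p, p \in s -> ~ forall x, X x -> peval p x = 0) ->
    exists2 x, X x & peval (\prod_(p <- s) p) x != 0.
  elim: s => [_|p s IH ns].
    by have [x Xx] := X0; exists x => //; rewrite big_nil peval1 oner_neq0.
  apply: contrapT => nx; have [|h|h] := Xirr p (\prod_(p <- s) p).
  - move=> x Xx; apply/eqP/negPn/negP => nz; apply: nx; exists x => //.
    by rewrite big_cons pevalM.
  - exact: (ns p (mem_head _ _)).
  - have [|x Xx] := IH; first by move=> p' p's; apply: ns; rewrite inE p's orbT.
    by rewrite h ?eqxx.
have bad (bc : seq {mpoly k[m]} * seq {mpoly k[m]}) : exists p,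
    (~ forall x, X x -> peval p x = 0) /\
    ((exists2 p', p' \in bc.1 & p' = p) \/
     (forall p', p' \in bc.1 -> forall x, X x -> peval p' x = 0)).
  have [[p pin np]|h] :=
    pselect (exists2 p, p \in bc.1 & ~ forall x, X x -> peval p x = 0).
    by exists p; split=> //; left; exists p.
  exists 1; split.
    by have [x Xx] := X0; move/(_ x Xx)/eqP; rewrite peval1 oner_eq0.
  right=> p' p'in; apply: contrapT => np; apply: h; by exists p'.
(* If every clause of the disjunctive normal form imposed an equation that is
   nontrivial on X, their product would vanish on the dense projection. *)
have [w wP] := choice bad.
have [x Xx wx] : exists2 x, X x & peval (\prod_(p <- map w bcs) p) x != 0.
  by apply: prodN => p /mapP[bc _ ->]; have [] := wP bc.
have [y [Xy py wy]] : exists y,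
    [/\ X y, projection ps q y & peval (\prod_(p <- map w bcs) p) y != 0].
  apply: contrapT => ny; move/negP: wx; apply; apply/eqP; apply: Xdense Xx => z Xz pz.
  by apply/eqP/negPn/negP => nz; apply: ny; exists z.
have [bc bcin [h1 h2]] := (bcsP y).1 py.
have [_ [[p' p'in p'E]|van]] := wP bc.
  move/negP: wy; case; rewrite big_map (big_rem bc) //= pevalM -p'E h1 //.
  by rewrite mul0r.
exists (\prod_(p <- bc.2) p); split.
  exists y => //; elim: (bc.2) h2 => [|p s IH] h2.
    by rewrite big_nil peval1 oner_neq0.
  rewrite big_cons pevalM; apply: mulf_neq0; first exact: h2 (mem_head _ _).
  by apply: IH => p1 p1s; apply: h2; rewrite inE p1s orbT.
move=> z Xz bz; apply/bcsP; exists bc => //; split=> [p /van/(_ z Xz)//|p pin].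
by move: bz; rewrite (big_rem p) //= pevalM mulf_eq0 negb_or => /andP[].
Qed.

End Chevalley.

(** * Density of the union of the graphs of the iterates *)
Section Descent.
Context (k : fieldType) (V : kspace k) (phi : V -> V).
Hypothesis V_irr : irreducible_set [set: V].
Hypothesis phi_aut : automorphism phi.

Lemma generically_automorphism (f : V -> V) (P : V -> Prop) :
  automorphism f -> generically P -> generically (fun x => P (f x)).
Proof.
move=> [fm [g [_ _ gK]]] [O [oO dO OP]].
have [x0 _] := V_irr.1.
have [w [_ Ow]] := dO setT (ex_intro _ x0 I) openT.
rewrite -(gK w) in Ow.
have nO := regular_at_near (fm (g w)) (open_near oO Ow).
apply: genericallyS (generically_near V_irr nO).
by move=> x /OP.
Qed.

Lemma generically_zero_or_neq0 (f : V -> k) : generically (fun x => reg x f) ->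
  generically (fun x => f x = 0) \/ generically (fun x => f x != 0).
Proof.
move=> rf; have [[x [rx fx]]|h] := pselect (exists x, reg x f /\ f x != 0).
  by right; apply: generically_near V_irr (reg_neq0 rx fx).
left; apply: genericallyS rf => x rx; apply/eqP/negPn/negP => fx.
by apply: h; exists x.
Qed.

Hypothesis no_inv : ~ exists lam : ratfun V,
  invariant_ratfun (rat_of_morphism (proj1 phi_aut)) lam /\ ~ constant_ratfun lam.

Lemma invariant_constant (f : V -> k) : generically (fun x => reg x f) ->
  generically (fun x => f (phi x) = f x) -> exists c, generically (fun x => f x = c).
Proof.
move=> [O [oO dO Of]] inv_f.
pose lam := RatFun oO dO Of.
have gO : generically O by exists O.
have : constant_ratfun lam.
  apply: contrapT => nc; apply: no_inv; exists lam; split=> //.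
  have gOphi := generically_automorphism phi_aut gO.
  apply: genericallyS (genericallyI (genericallyI gO gOphi) inv_f).
  move=> x [[Ox Opx] fx]; split=> //; exists (phi x); split=> //.
  exists (rat_of_morphism (proj1 phi_aut)); split=> //.
  exact: genericallyT.
by move=> [c gc]; exists c; apply: genericallyS gc => x [].
Qed.

(** Descent of a space of relations that is stable under phi: it is spanned by
    relations over the field of invariants.  Since the invariants are constants,
    a relation between the coordinates of a and phi^n(a) for all n is trivial.
    The argument is an induction on the number m of terms. *)
Lemma descent m (c u : nat -> V -> k) :
  (forall i, (i < m)%N -> generically (fun x => reg x (c i))) ->
  (forall n, generically (fun a => \sum_(i < m) c i a * u i (iter n phi a) = 0)) ->
  generically (fun b => generically (fun a => \sum_(i < m) c i a * u i b = 0)).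
Proof.
have [phim [psi [psim phiK psiK]]] := phi_aut.
have psi_aut : automorphism psi by split=> //; exists phi.
elim: m c => [|m IH] c rc sum0.
  by do 2!apply: genericallyT => ?; rewrite big_ord0.
have rc' i : (i < m)%N -> generically (fun x => reg x (c i)).
  by move=> im; apply: rc; exact: ltnW.
have [cm0|cm0] := generically_zero_or_neq0 (rc m (ltnSn m)).
  have := IH c rc'; case.
    move=> n; apply: genericallyS (genericallyI (sum0 n) cm0) => a [sa cma].
    by move: sa; rewrite big_ord_recr /= cma mul0r addr0.
  move=> O [oO dO OP]; exists O; split=> // b /OP gb.
  apply: genericallyS (genericallyI gb cm0) => a [sb cma].
  by rewrite big_ord_recr /= sb cma mul0r addr0.
(* After division by c m the last coefficient is 1, so it disappears from the
   difference of the relation and its translate by psi = phi^-1. *)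
pose c' i a := c i a / c m a.
pose d i a := c' i a - c' i (psi a).
have rc1 i : (i < m)%N -> generically (fun x => reg x (c' i)).
  move=> im; have rim := genericallyI (rc' i im) (rc m (ltnSn m)).
  apply: genericallyS (genericallyI rim cm0).
  by move=> x [[ri rm] m0]; exact: reg_div.
have rd i : (i < m)%N -> generically (fun x => reg x (d i)).
  move=> im; have rpsi := generically_automorphism psi_aut (rc1 i im).
  apply: genericallyS (genericallyI (rc1 i im) rpsi).
  by move=> x [ri rpi]; apply: reg_sub => //; exact: (regular_at_reg (psim x) rpi).
pose F a b := \sum_(i < m) c' i a * u i b + u m b.
have sumF a b : c m a != 0 -> \sum_(i < m.+1) c i a * u i b = c m a * F a b.
  move=> cma; rewrite big_ord_recr /= mulrDr mulr_sumr; congr (_ + _).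
  by apply: eq_bigr => i _; rewrite mulrA mulrCA divff // mulr1.
have F0 n : generically (fun a => F a (iter n phi a) = 0).
  apply: genericallyS (genericallyI (sum0 n) cm0) => a [+ cma].
  by rewrite sumF // => /eqP; rewrite mulf_eq0 (negbTE cma) => /eqP.
have [|O [oO dO OP]] := IH d rd.
  move=> n; apply: genericallyS (genericallyI (F0 n)
    (generically_automorphism psi_aut (F0 n.+1))) => a [Fa].
  rewrite iterSr psiK => Fpa.
  transitivity (F a (iter n phi a) - F (psi a) (iter n phi a)); last first.
    by rewrite Fa Fpa subr0.
  rewrite /F opprD addrACA subrr addr0 -sumrB; apply: eq_bigr => i _.
  by rewrite /d mulrBl.
have g1 : generically (fun b => forall i : 'I_m, reg b (c' i)).
  by apply: generically_all => i; exact: rc1.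
have gO := ex_intro _ O (And3 oO dO OP) : generically _.
apply: genericallyS (genericallyI (genericallyI gO g1) (F0 0%N)).
move=> b [[db rb] Fb].
pose f a := \sum_(i < m) c' i a * u i b.
have rf a : (forall i : 'I_m, reg a (c' i)) -> reg a f.
  by move=> ra; apply: reg_sum => i; apply: reg_mul => //; exact: reg_cst.
have [e fe] : exists e, generically (fun a => f a = e).
  apply: invariant_constant; first by apply: genericallyS g1; exact: rf.
  apply: genericallyS (generically_automorphism phi_aut db) => a.
  rewrite /d phiK; under eq_bigr do rewrite mulrBl.
  by rewrite sumrB => /eqP; rewrite subr_eq0 => /eqP.
(* The constant is read off on the diagonal, where the relation for n = 0 holds. *)
have fb : f b = e.
  have cl := closure_dense (x := b) (generically_dense fe).
  apply: (reg_eq_closure cl (rf b rb) (reg_cst b e)).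
  by move=> a.
apply: genericallyS (genericallyI fe cm0) => a [fa cma].
by rewrite sumF // /F -/(f a) fa -fb [f b + _]Fb mulr0.
Qed.

End Descent.

(** * The algebraic family that contains the iterates *)
Section Parametrization.
Context (k : fieldType).
Implicit Types V W X : kspace k.

Lemma irreducible_sub V (S : set V) :
  irreducible_set S -> irreducible_set [set: sub_space S].
Proof.
move=> [[s0 Ss0] irr]; apply: hyperconnected_irreducible.
  by exists (exist _ s0 (mem_set Ss0)).
move=> O O' [B oB <-] [s Bs] [B' oB' <-] [s' B's'].
have SP (u : sub_space S) : S (\val u) by exact: set_valP.
apply: contrapT => OO'.
have [v Sv|h|h] := irr (~` B) (~` B') (open_closedC oB) (open_closedC oB').
- have [Bv|] := pselect (B v); last by left.
  by right=> B'v; apply: OO'; exists (exist _ v (mem_set Sv)).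
- exact: h _ (SP s) Bs.
- exact: h _ (SP s') B's'.
Qed.

Lemma birational_meets_opens V W (g : ratmap V W) : birational g -> meets_opens g.
Proof.
move=> [h [_ hg]] O oO O0; have [y Oy [x _ gxy]] := generically_meets hg oO O0.
exact: rat_val_meets gxy oO Oy.
Qed.

Lemma rat_prod_meets_opens V V' W W' (f : ratmap V V') (g : ratmap W W') :
  meets_opens f -> meets_opens g -> meets_opens (rat_prod f g).
Proof.
move=> mf mg O oO [[v w] Ovw].
have /nbhs_openP[A [oA Av] AO] := fst_slice oO Ovw.
have [x fx Afx] := mf A oA (ex_intro _ v Av).
have /nbhs_openP[B [oB Bw] BO] := snd_slice oO (AO _ Afx).
have [y gy Bgy] := mg B oB (ex_intro _ w Bw).
by exists (x, y) => //; exact: BO.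
Qed.

Lemma automorphism_meets_opens V (f : V -> V) (f_aut : automorphism f) :
  meets_opens (rat_of_morphism (proj1 f_aut)).
Proof.
have [fm [g [_ _ gK]]] := f_aut.
by move=> O oO [w Ow]; exists (g w) => //=; rewrite gK.
Qed.

Lemma rat_prod_iter V W (f : ratmap V V) (g : ratmap W W) n p :
  iter n (rat_prod f g) p = (iter n f p.1, iter n g p.2).
Proof. by elim: n => [|n IH]; [case: p|rewrite iterS IH]. Qed.

Lemma generically_iter V (f : ratmap V V) (P : V -> Prop) n :
  irreducible_set [set: V] -> meets_opens f -> generically P ->
  generically (fun x => P (iter n f x)).
Proof.
move=> irr mf; elim: n => [//|n IH] gP.
by apply: genericallyS (generically_preimage irr mf (IH gP)) => x [_]; rewrite iterSr.
Qed.

Section Isotrivial.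
Variables (V Z : kspace k) (phi : ratmap V V) (psi : ratmap Z Z) (l : nat).
Variable Y : set (prod_space (affine_space k l) Z).
Variables (rho : ratmap (sub_space Y) (sub_space Y)).
Variable g : ratmap (prod_space V Z) (sub_space Y).
Variable h : ratmap (sub_space Y) (prod_space V Z).
Hypotheses (V_irr : irreducible_set [set: V]) (Z_irr : irreducible_set [set: Z]).
Hypotheses (V_lim : unique_limits V) (Z_lim : unique_limits Z).
Hypotheses (phi_meets : meets_opens phi) (psi_meets : meets_opens psi).
Hypothesis rho_restricts : restricts_to (rat_prod (rat_id (affine_space k l)) psi) rho.
Hypotheses (g_meets : meets_opens g) (gh : generically (fun p => rat_comp g h p p)).
Hypothesis g_equi : equivariant (rat_prod phi psi) rho g.
Hypothesis g_over : over_base g.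

Local Notation Psi := (rat_prod phi psi).
Let VZ_irr := prod_irreducible V_irr Z_irr.
Let Psi_meets : meets_opens Psi := rat_prod_meets_opens phi_meets psi_meets.
Let VZ_lim := prod_unique_limits V_lim Z_lim.
Let AZ_lim := prod_unique_limits (@affine_unique_limits k l) Z_lim.
Let Y_lim : unique_limits (sub_space Y) := sub_unique_limits AZ_lim.
Let g_dom : generically (rdom g).
Proof. by exists (rdom g); split=> //; [exact: rdom_open|exact: rdom_dense]. Qed.
Let h_dom : generically (rdom h).
Proof. by exists (rdom h); split=> //; [exact: rdom_open|exact: rdom_dense]. Qed.

Lemma isotrivial_base : generically (fun p => (\val (g p)).2 = p.2).
Proof.
apply: genericallyS (genericallyI g_dom g_over) => p [gp [q gpq <-]].
by rewrite (rat_val_rdom Y_lim gp gpq).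
Qed.

Lemma isotrivial_inverse : generically (fun p => rdom h (g p) /\ h (g p) = p).
Proof.
apply: genericallyS (genericallyI (genericallyI g_dom
  (generically_preimage VZ_irr g_meets h_dom)) gh).
move=> p [[gp [_ hgp]] [q /(rat_val_rdom Y_lim gp) -> hgpp]]; split=> //.
by rewrite -(rat_val_rdom VZ_lim hgp hgpp).
Qed.

Lemma isotrivial_invariant :
  generically (fun p => (\val (g (Psi p))).1 = (\val (g p)).1).
Proof.
have rho_dom : generically (rdom rho).
  by exists (rdom rho); split=> //; [exact: rdom_open|exact: rdom_dense].
have gr := generically_preimage VZ_irr g_meets (genericallyI rho_dom rho_restricts).
have gPsi := generically_preimage VZ_irr Psi_meets g_dom.
have ge := genericallyI isotrivial_base g_equi.
apply: genericallyS (genericallyI (genericallyI gr gPsi) ge).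
move=> p [[[gp [rhogp [y /(rat_val_rdom Y_lim rhogp) -> idpsi]]] [Psip gPsip]]].
move=> [gp2 [c]].
move=> [q /(rat_val_rdom Y_lim gp) -> /(rat_val_rdom Y_lim rhogp) cE].
move=> [q' /(rat_val_rdom VZ_lim Psip) -> /(rat_val_rdom Y_lim gPsip) cE'].
rewrite -cE' cE.
have idom : rdom (rat_prod (rat_id (affine_space k l)) psi) (\val (g p)).
  by split=> //=; rewrite gp2; exact: Psip.2.
by rewrite (rat_val_rdom AZ_lim idom idpsi).
Qed.

(** By induction on n: what holds generically still does after an application of
    phi * psi, because this map is dominant. *)
Lemma isotrivial_orbit n : generically (fun p =>
  \val (g (iter n Psi p)) = ((\val (g p)).1, iter n psi p.2)).
Proof.
elim: n => [|n IH].
  by apply: genericallyS isotrivial_base => p <-; exact: surjective_pairing.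
apply: genericallyS (genericallyI (generically_preimage VZ_irr Psi_meets IH)
  isotrivial_invariant).
by move=> p [[_ gp] inv]; rewrite iterSr gp inv iterSr.
Qed.

End Isotrivial.

Section Coordinates.
Variables (V : kspace k) (phi : V -> V) (phi_aut : automorphism phi).
Hypothesis V_var : irreducible_variety V.
Variables (V0 : set V) (r : nat) (x : V -> affine_space k r).
Hypotheses (x_chart : chart V0 x) (V0_ne : V0 !=set0).

(** The entries with vanishing denominator are 0, which is why this is always
    used together with [defined_at]. *)
Definition quotients m n (R S : 'I_n -> {mpoly k[m]}) (y : affine_space k m) :
    affine_space k n :=
  \row_j (peval (R j) y / peval (S j) y).

Definition defined_at m n (S : 'I_n -> {mpoly k[m]}) (y : affine_space k m) :=
  forall j, peval (S j) y != 0.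

(** In coordinates, g and h are given by quotients of polynomials, and
    h(G(a, z), psi^n(z)) has phi^n(a) as its first component.  Only the
    coordinates of z and of psi^n(z) enter the right-hand side; the index n
    does not occur in the polynomials. *)
Lemma isotrivial_parametrization : isotrivial (rat_of_morphism (proj1 phi_aut)) ->
  exists (Z : kspace k) s (t : Z -> affine_space k s)
    (tn : nat -> Z -> affine_space k s) l
    (R S : 'I_l -> {mpoly k[r + s]}) (P Q : 'I_r -> {mpoly k[l + s]}),
    irreducible_set [set: Z] /\
    forall n, generically (fun p : prod_space V Z =>
      let y := row_mx (x p.1) (t p.2) in
      let y' := row_mx (quotients R S y) (tn n p.2) in
      [/\ V0 p.1, V0 (iter n phi p.1), defined_at S y, defined_at Q y' &
          x (iter n phi p.1) = quotients P Q y']).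
Proof.
have [[V_sep _] V_irr] := V_var.
move=> [Z [psi [[Z_var psi_dom] [l [Y [[Y_irr _ _ _]]]]]]].
move=> [rho [g [rho_res g_bir g_equi g_over]]].
have [[Z_sep _] Z_irr] := Z_var.
have [h [gh hg]] := g_bir.
have g_meets := birational_meets_opens g_bir.
have V_lim := separated_unique_limits V_sep.
have Z_lim := separated_unique_limits Z_sep.
have phi_meets := automorphism_meets_opens phi_aut.
have psi_meets := dominant_meets_opens psi_dom.
set phir := rat_of_morphism _ in g_equi phi_meets.
pose Psi := rat_prod phir psi.
have VZ_irr := prod_irreducible V_irr Z_irr.
have Psi_meets : meets_opens Psi := rat_prod_meets_opens phi_meets psi_meets.
have SY_irr := irreducible_sub Y_irr.
have inverse := isotrivial_inverse V_irr Z_irr V_lim Z_lim g_meets gh.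
have orbit := isotrivial_orbit V_irr Z_irr V_lim Z_lim phi_meets psi_meets
  rho_res g_meets g_equi g_over.
have [Z0 [s [t [t_chart Z0_ne _]]]] := variety_chart Z_var.
have VZ_chart := chart_prod x_chart t_chart.
have SY_chart := chart_sub Y (chart_prod (chart_affine k l) t_chart).
have g_dom : generically (rdom g).
  by exists (rdom g); split=> //; [exact: rdom_open|exact: rdom_dense].
have VZ0 : generically (fun p : prod_space V Z => V0 p.1 /\ Z0 p.2).
  apply: generically_open => //; first exact: chart_open VZ_chart.
  by have [v V0v] := V0_ne; have [z Z0z] := Z0_ne; exists (v, z).
have [p0 [[[gp0 [V0p0 Z0p0]] [hgp0 hgp0E]] gp0E]] := generically_nonempty VZ_irr
  (genericallyI (genericallyI (genericallyI g_dom VZ0) inverse) (orbit 0%N)).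
have /choice[RS RSP] : forall j : 'I_l, exists RS : {mpoly k[r + s]} * {mpoly k[r + s]},
    generically (fun p : prod_space V Z => [/\ V0 p.1 /\ Z0 p.2,
      peval RS.2 (prod_chart x t p) != 0 &
      ((\val (g p)).1 : 'rV[k]_l) ord0 j =
        peval RS.1 (prod_chart x t p) / peval RS.2 (prod_chart x t p)]).
  move=> j.
  have rG : reg p0 (fun p => ((\val (g p)).1 : 'rV[k]_l) ord0 j).
    have ra := regular_at_comp (regular_at_comp (rfun_regular gp0) (val_regular (g p0)))
      (fst_regular _).
    exact: coord_regular_at j ra.
  have [R [S RS]] := chart_quotient VZ_irr VZ_chart (conj V0p0 Z0p0) rG.
  by exists (R, S).
have /choice[PQ PQP] : forall i : 'I_r, exists PQ : {mpoly k[l + s]} * {mpoly k[l + s]},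
    generically (fun y : sub_space Y => let y' := prod_chart id t (\val y) in
      peval PQ.2 y' != 0 /\
      (x (h y).1 : 'rV[k]_r) ord0 i = peval PQ.1 y' / peval PQ.2 y').
  move=> i.
  have rH : reg (g p0) (fun y => (x (h y).1 : 'rV[k]_r) ord0 i).
    have rx : regular_at (h (g p0)).1 x.
      by rewrite hgp0E; exact: chart_regular x_chart _ V0p0.
    have ra := regular_at_comp (regular_at_comp (rfun_regular hgp0) (fst_regular _)) rx.
    exact: coord_regular_at i ra.
  have gp0Y : setT (\val (g p0)).1 /\ Z0 (\val (g p0)).2 by rewrite [X in Z0 X.2]gp0E.
  have [P [Q PQ]] := chart_quotient SY_irr SY_chart gp0Y rH.
  by exists (P, Q); apply: genericallyS PQ => y [_ ? ?].
exists Z, s, t, (fun n z => t (iter n psi z)), l,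
  (fun j => (RS j).1), (fun j => (RS j).2),
  (fun i => (PQ i).1), (fun i => (PQ i).2); split=> // n.
have gPQ := generically_preimage VZ_irr g_meets (generically_all PQP).
have late := generically_iter n VZ_irr Psi_meets
  (genericallyI (genericallyI gPQ inverse) VZ0).
apply: genericallyS (genericallyI (genericallyI VZ0 (generically_all RSP))
  (genericallyI late (orbit n))).
move=> p [[[V0p Z0p] RSp] [[[[_ PQp] [_ hgp]] [V0np _]] gnp]].
rewrite -/Psi in gnp.
have uE : quotients (fun j => (RS j).1) (fun j => (RS j).2)
    (row_mx (x p.1) (t p.2)) = (\val (g p)).1.
  by apply/rowP => j; rewrite mxE; have [_ _ ->] := RSp j.
have nE : (iter n Psi p).1 = iter n phi p.1 by rewrite rat_prod_iter.
rewrite nE in V0np; rewrite hgp gnp nE in PQp.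
split=> //.
- by move=> j; have [_ ? _] := RSp j.
- by move=> i; rewrite uE; have [? _] := PQp i.
- by apply/rowP => i; rewrite uE mxE; have [_ ->] := PQp i.
Qed.

End Coordinates.
End Parametrization.

(** * Polynomial maps and closures *)
Section PolynomialMaps.
Context (k : fieldType).

Definition polymap n m (f : affine_pts k n -> affine_pts k m) :=
  forall p, exists q, forall v, peval p (f v) = peval q v.

Lemma polymapP n m (f : affine_pts k n -> affine_pts k m) :
  (forall i, exists q, forall v, (f v : 'rV[k]_m) ord0 i = peval q v) -> polymap f.
Proof.
move=> /choice[q qE] p; exists (p \mPo [tuple q i | i < m]) => v.
rewrite /peval comp_mpoly_meval; apply: meval_eq => i.
by rewrite tnth_mktuple qE.
Qed.

Lemma polymap_coord n m (f : affine_pts k n -> affine_pts k m) i : polymap f ->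
  exists q, forall v, (f v : 'rV[k]_m) ord0 i = peval q v.
Proof.
by move=> pf; have [q qE] := pf 'X_i; exists q => v; rewrite -qE /peval mevalXU.
Qed.

Lemma polymap_id n : polymap (@id (affine_pts k n)).
Proof. by move=> p; exists p. Qed.

Lemma polymap_lsubmx n m m' (f : affine_pts k n -> affine_pts k (m + m')) :
  polymap f -> polymap (fun v => lsubmx (f v : 'rV[k]_(m + m')) : affine_pts k m).
Proof.
move=> pf; apply: polymapP => i; have [q qE] := polymap_coord (lshift m' i) pf.
by exists q => v; rewrite mxE qE.
Qed.

Lemma polymap_rsubmx n m m' (f : affine_pts k n -> affine_pts k (m + m')) :
  polymap f -> polymap (fun v => rsubmx (f v : 'rV[k]_(m + m')) : affine_pts k m').
Proof.
move=> pf; apply: polymapP => i; have [q qE] := polymap_coord (rshift m i) pf.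
by exists q => v; rewrite mxE qE.
Qed.

Lemma polymap_row_mx n m m' (f : affine_pts k n -> affine_pts k m)
    (g : affine_pts k n -> affine_pts k m') : polymap f -> polymap g ->
  polymap (fun v => row_mx (f v : 'rV[k]_m) (g v : 'rV[k]_m') : affine_pts k (m + m')).
Proof.
move=> pf pg; apply: polymapP => i; case: (fintype.splitP i) => j ij.
  have [q qE] := polymap_coord j pf; exists q => v.
  have -> : i = lshift m' j by exact: val_inj.
  by rewrite -qE row_mxEl.
have [q qE] := polymap_coord j pg; exists q => v.
have -> : i = rshift m j by exact: val_inj.
by rewrite -qE row_mxEr.
Qed.

Lemma affine_closure_zeros n (E : set (affine_space k n)) :
  exists2 s : seq {mpoly k[n]},
    (forall p, p \in s -> forall v, closure E v -> peval p v = 0) &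
    forall v, (forall p, p \in s -> peval p v = 0) -> closure E v.
Proof.
have [|s sE sz] := @ideal_zeros_finite k n (fun p => forall e, E e -> peval p e = 0).
  move=> p q c m p0 q0 e Ee.
  have -> : peval (p - c *: 'X_[m] * q) e = peval p e - peval (c *: 'X_[m]) e * peval q e.
    by rewrite -pevalM; exact: mevalB.
  by rewrite p0 // q0 // mulr0 subr0.
exists s => [p /sE pE v Ev|v vs A /affine_nbhsP[p pv pA]].
  exact: (reg_eq_closure Ev (peval_reg v p) (reg_cst v 0)).
apply: contrapT => EA; move/eqP: pv; apply.
apply: (sz (fun i => (v : 'rV[k]_n) ord0 i) vs p) => e Ee.
by apply/eqP/negPn/negP => /pA Ae; apply: EA; exists e.
Qed.

End PolynomialMaps.

(** * Points with a dense orbit *)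
Section Quotients.
Context (k : fieldType).

Lemma quotients_regular (V : kspace k) m n (R S : 'I_n -> {mpoly k[m]})
    (f : V -> affine_space k m) v :
  regular_at v f -> defined_at S (f v) ->
  regular_at v (fun w => quotients R S (f w) : affine_space k n).
Proof.
move=> rf Sv; apply: affine_regular => j; under eq_fun do rewrite mxE.
have rp p := regular_at_reg rf (peval_reg (f v) p).
by apply: reg_div; [exact: rp|exact: rp|exact: Sv].
Qed.

Lemma defined_at_near (V : kspace k) m n (S : 'I_n -> {mpoly k[m]})
    (f : V -> affine_space k m) v :
  regular_at v f -> defined_at S (f v) -> \forall w \near v, defined_at S (f w).
Proof.
move=> rf Sv.
apply: (@filter_forall _ _ (fun j w => peval (S j) (f w) != 0) _ (nbhs_filter v)) => j.
exact: reg_neq0 (regular_at_reg rf (peval_reg (f v) (S j))) (Sv j).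
Qed.

End Quotients.

Section Assembly.
Context (k : closedFieldType) (V : kspace k) (phi : V -> V).
Hypotheses (V_irr : irreducible_set [set: V]) (V_lim : unique_limits V).
Hypothesis phi_aut : automorphism phi.
Hypothesis no_inv : ~ exists lam : ratfun V,
  invariant_ratfun (rat_of_morphism (proj1 phi_aut)) lam /\ ~ constant_ratfun lam.
Variables (V0 : set V) (r : nat) (x : V -> affine_space k r).
Hypotheses (x_chart : chart V0 x) (V0_ne : V0 !=set0).
Hypothesis x_closed : closed [set x v | v in V0].
Variables (Z : kspace k) (s : nat) (t : Z -> affine_space k s).
Variable tn : nat -> Z -> affine_space k s.
Variables (l : nat) (R S : 'I_l -> {mpoly k[r + s]}) (P Q : 'I_r -> {mpoly k[l + s]}).
Hypothesis Z_irr : irreducible_set [set: Z].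
Hypothesis param : forall n, generically (fun p : prod_space V Z =>
  let y := row_mx (x p.1) (t p.2) in
  let y' := row_mx (quotients R S y) (tn n p.2) in
  [/\ V0 p.1, V0 (iter n phi p.1), defined_at S y, defined_at Q y' &
      x (iter n phi p.1) = quotients P Q y']).

(** The point (G(a, z), w) of Y in coordinates. *)
Definition trace_point (a : affine_space k r) (z w : affine_space k s) :
    affine_space k (l + s) :=
  row_mx (quotients R S (row_mx a z)) w.
Definition transport_defined a z w :=
  defined_at S (row_mx a z) /\ defined_at Q (trace_point a z w).
(** The first component of h(G(a, z), w) in coordinates: a point is sent to
    A^l along z and brought back along w. *)
Definition transport a z w : affine_space k r := quotients P Q (trace_point a z w).

Lemma trace_point_regular (W : kspace k) (f : W -> affine_space k r)
    (gz gw : W -> affine_space k s) v :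
  regular_at v f -> regular_at v gz -> regular_at v gw ->
  defined_at S (row_mx (f v) (gz v)) ->
  regular_at v (fun u => trace_point (f u) (gz u) (gw u)).
Proof.
move=> rf rz rw Sv; apply: row_mx_regular => //.
apply: (@quotients_regular _ W _ _ R S (fun u => row_mx (f u) (gz u))) => //.
exact: row_mx_regular.
Qed.

Lemma transport_regular (W : kspace k) (f : W -> affine_space k r)
    (gz gw : W -> affine_space k s) v :
  regular_at v f -> regular_at v gz -> regular_at v gw ->
  transport_defined (f v) (gz v) (gw v) ->
  regular_at v (fun u => transport (f u) (gz u) (gw u)).
Proof.
move=> rf rz rw [Sv Qv].
apply: (@quotients_regular _ W _ _ P Q (fun u => trace_point (f u) (gz u) (gw u))) => //.
exact: trace_point_regular.
Qed.

Lemma transport_defined_near (W : kspace k) (f : W -> affine_space k r)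
    (gz gw : W -> affine_space k s) v :
  regular_at v f -> regular_at v gz -> regular_at v gw ->
  transport_defined (f v) (gz v) (gw v) ->
  \forall u \near v, transport_defined (f u) (gz u) (gw u).
Proof.
move=> rf rz rw [Sv Qv].
have n1 := defined_at_near (row_mx_regular rf rz) Sv.
have n2 := defined_at_near (trace_point_regular rf rz rw Sv) Qv.
exact: filterI n1 n2.
Qed.

(** Agreement with an iterate is required wherever the quotients are defined, and
    not only generically, so that it can be used at any given point a. *)
Definition iterate_parameters : set (affine_space k (s + s)) :=
  [set e | exists n, forall a, V0 a ->
     transport_defined (x a) (lsubmx e) (rsubmx e) ->
     V0 (iter n phi a) /\ x (iter n phi a) = transport (x a) (lsubmx e) (rsubmx e)].

(** For fixed a, the polynomial f composed with the transport is a regular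
    function of (z, w) which vanishes at the parameters of iterates. *)
Lemma orbit_closure a z w (f : {mpoly k[r]}) :
  V0 a -> closure iterate_parameters (row_mx z w) ->
  transport_defined (x a) z w ->
  (forall n, V0 (iter n phi a) -> peval f (x (iter n phi a)) = 0) ->
  peval f (transport (x a) z w) = 0.
Proof.
move=> V0a Ee gd f0; pose e0 : affine_space k (s + s) := row_mx z w.
pose lz (e : affine_space k (s + s)) : affine_space k s := lsubmx e.
pose rw (e : affine_space k (s + s)) : affine_space k s := rsubmx e.
have lzE : lz e0 = z by exact: row_mxKl.
have rwE : rw e0 = w by exact: row_mxKr.
have gd0 : transport_defined (x a) (lz e0) (rw e0) by rewrite lzE rwE.
have rlz : regular_at e0 lz := lsubmx_regular e0.
have rrw : regular_at e0 rw := rsubmx_regular e0.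
have rT := transport_regular (cst_regular (x a) e0) rlz rrw gd0.
have nT := transport_defined_near (cst_regular (x a) e0) rlz rrw gd0.
rewrite -lzE -rwE.
have rfT := regular_at_reg rT (peval_reg _ f).
apply: (reg_eq_closure (closure_nbhsI Ee nT) rfT (reg_cst e0 0)).
move=> e [[n En] ge] /=.
by have [V0n <-] := En a V0a ge; exact: f0.
Qed.

Lemma iter_morphism n : morphism (iter n phi).
Proof.
elim: n => [|n IH] v; first exact: regular_at_id.
exact: regular_at_comp (IH v) (proj1 phi_aut _).
Qed.

(** For general z the pair (z, psi^n(z)) is a parameter of phi^n.  The identity is
    known for general a only; it extends to all a at which the transport is
    defined, since x(V0) is closed and V is separated. *)
Lemma graph_parameter n : exists z w, iterate_parameters (row_mx z w) /\
  generically (fun a => [/\ V0 a, V0 (iter n phi a), transport_defined (x a) z w &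
    x (iter n phi a) = transport (x a) z w]).
Proof.
have [z0 gz0] := generically_nonempty Z_irr (generically_slice V_irr Z_irr (param n)).
pose z := t z0; pose w := tn n z0.
have gen : generically (fun a =>
    [/\ V0 a, V0 (iter n phi a), transport_defined (x a) z w &
    x (iter n phi a) = transport (x a) z w]).
  by apply: genericallyS gz0 => a [].
exists z, w; split=> //; exists n; rewrite row_mxKl row_mxKr => a0 V0a0 ga0.
have th_reg a : V0 a -> transport_defined (x a) z w ->
    regular_at a (fun u => transport (x u) z w).
  move=> V0a ga; apply: (transport_regular (f := x)) => //; try exact: cst_regular.
  exact: chart_regular x_chart _ V0a.
have gd_near a : V0 a -> transport_defined (x a) z w ->
    \forall u \near a, V0 u /\ transport_defined (x u) z w.
  move=> V0a ga; apply: filterI (open_near (chart_open x_chart) V0a) _.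
  apply: (transport_defined_near (f := x)) => //; try exact: cst_regular.
  exact: chart_regular x_chart _ V0a.
have dgen := generically_dense gen.
(* eta lifts the transport to V; it is the map to be compared with the iterate,
   because only V itself is known to be separated. *)
have /choice[eta etaP] : forall a, exists b, V0 a ->
    transport_defined (x a) z w -> V0 b /\ x b = transport (x a) z w.
  move=> a.
  have [[V0a ga]|na] := pselect (V0 a /\ transport_defined (x a) z w); last first.
    by exists a => V0a ga; case: na.
  (* The transport takes values in the closed set x(V0) on a dense set. *)
  suff [b V0b xb] : [set x v | v in V0] (transport (x a) z w) by exists b.
  apply: x_closed => B /(regular_at_near (th_reg a V0a ga)) nB.
  have [u [[V0u V0nu _ xnu] Bu]] := closure_dense (x := a) dgen nB.
  by exists (transport (x u) z w); split=> //; exists (iter n phi u).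
have eta_reg : regular_at a0 eta.
  have [V0e xe] := etaP a0 V0a0 ga0.
  have pull (B : affine_space k r -> Prop) : (\forall y \near x (eta a0), B y) ->
      \forall u \near a0,
        [/\ V0 u, transport_defined (x u) z w & B (transport (x u) z w)].
    rewrite xe => /(regular_at_near (th_reg a0 V0a0 ga0)) nB.
    by apply: filterS2 (gd_near a0 V0a0 ga0) nB => u [? ?] ?.
  split=> [A /(chart_nbhs x_chart V0e)/pull|h rh].
    apply: filterS => u [V0u gu Au]; have [V0eu xeu] := etaP u V0u gu.
    exact: Au.
  have [g rg /pull hg] := chart_reg x_chart V0e rh.
  rewrite xe in rg.
  apply: reg_local (regular_at_reg (th_reg a0 V0a0 ga0) rg).
  apply: filterS hg => u [V0u gu hu]; have [V0eu xeu] := etaP u V0u gu.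
  by rewrite /= (hu (eta u)).
have etaE : eta a0 = iter n phi a0.
  apply: (V_lim (closure_dense (x := a0) dgen) eta_reg (iter_morphism n a0)).
  move=> a [V0a V0na ga xna]; have [V0ea xea] := etaP a V0a ga.
  by apply: (chart_inj x_chart) => //; rewrite xea.
by rewrite -etaE; exact: etaP.
Qed.

Definition transport_graph (ab : affine_pts k (r + r)) :=
  exists z w, [/\ closure iterate_parameters (row_mx z w),
  transport_defined (lsubmx ab) z w & rsubmx ab = transport (lsubmx ab) z w].

Lemma parametrization_projection :
  exists e (ps : seq {mpoly k[(r + r) + e]}) q,
    forall ab, transport_graph ab <-> projection ps q ab.
Proof.
have [tau tau_E Etau] := affine_closure_zeros iterate_parameters.
pose N := ((r + r) + ((s + s) + l))%N.
pose ab_ (v : affine_pts k N) : affine_pts k (r + r) := lsubmx (v : 'rV[k]_N).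
pose eu_ (v : affine_pts k N) : affine_pts k ((s + s) + l) := rsubmx (v : 'rV[k]_N).
pose a_ v : affine_pts k r := lsubmx (ab_ v : 'rV[k]_(r + r)).
pose b_ v : affine_pts k r := rsubmx (ab_ v : 'rV[k]_(r + r)).
pose e_ v : affine_pts k (s + s) := lsubmx (eu_ v : 'rV[k]_(s + s + l)).
pose u_ v : affine_pts k l := rsubmx (eu_ v : 'rV[k]_(s + s + l)).
pose z_ v : affine_pts k s := lsubmx (e_ v : 'rV[k]_(s + s)).
pose w_ v : affine_pts k s := rsubmx (e_ v : 'rV[k]_(s + s)).
have pab : polymap ab_ by apply: polymap_lsubmx (@polymap_id _ _).
have peu : polymap eu_ by apply: polymap_rsubmx (@polymap_id _ _).
have pa : polymap a_ by exact: polymap_lsubmx.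
have pb : polymap b_ by exact: polymap_rsubmx.
have pe : polymap e_ by exact: polymap_lsubmx.
have pu : polymap u_ by exact: polymap_rsubmx.
have pz : polymap z_ by exact: polymap_lsubmx.
have pw : polymap w_ by exact: polymap_rsubmx.
have paz := polymap_row_mx pa pz.
have puw := polymap_row_mx pu pw.
have /choice[tau' tauP] := pe.
have /choice[az azP] := paz.
have /choice[uw uwP] := puw.
have /choice[cu cuP] : forall j,
    exists p, forall v, (u_ v : 'rV[k]_l) ord0 j = peval p v.
  by move=> j; exact: polymap_coord.
have /choice[cb cbP] : forall i,
    exists p, forall v, (b_ v : 'rV[k]_r) ord0 i = peval p v.
  by move=> i; exact: polymap_coord.
(* The denominators are cleared with one auxiliary variable per coordinate of
   the quotients R/S, so that Q and P are evaluated at a polynomial point. *)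
pose eqs := map tau' tau ++ map (fun j => cu j * az (S j) - az (R j)) (enum 'I_l) ++
  map (fun i => cb i * uw (Q i) - uw (P i)) (enum 'I_r).
pose ineq := \prod_j az (S j) * \prod_i uw (Q i).
have eqsP v : (forall p, p \in eqs -> peval p v = 0) <->
    [/\ forall p, p \in tau -> peval p (e_ v) = 0,
        forall j, (u_ v : 'rV[k]_l) ord0 j * peval (S j) (row_mx (a_ v) (z_ v)) =
           peval (R j) (row_mx (a_ v) (z_ v)) &
        forall i, (b_ v : 'rV[k]_r) ord0 i * peval (Q i) (row_mx (u_ v) (w_ v)) =
           peval (P i) (row_mx (u_ v) (w_ v))].
  have subE p q : peval (p - q) v = peval p v - peval q v by exact: mevalB.
  split=> [h|[h1 h2 h3] p].
    split=> [p ptau|j|i].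
    - by rewrite tauP; apply: h; rewrite mem_cat map_f.
    - rewrite cuP !azP -pevalM; apply/eqP; rewrite -subr_eq0 -subE; apply/eqP/h.
      by rewrite !mem_cat (map_f _ (mem_enum _ j)) !orbT.
    - rewrite cbP !uwP -pevalM; apply/eqP; rewrite -subr_eq0 -subE; apply/eqP/h.
      by rewrite !mem_cat (map_f _ (mem_enum _ i)) !orbT.
  rewrite !mem_cat => /or3P[] /mapP[i ii ->].
  - by rewrite -tauP; exact: h1.
  - by rewrite subE pevalM -cuP -!azP h2 subrr.
  - by rewrite subE pevalM -cbP -!uwP h3 subrr.
have ineqP v : peval ineq v != 0 <-> defined_at S (row_mx (a_ v) (z_ v)) /\
    defined_at Q (row_mx (u_ v) (w_ v)).
  have prodE (n : nat) (p : 'I_n -> {mpoly k[N]}) :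
      peval (\prod_i p i) v = \prod_i peval (p i) v.
    exact: rmorph_prod.
  rewrite /ineq pevalM mulf_eq0 negb_or !prodE; split.
    move=> /andP[/prodf_neq0 h1 /prodf_neq0 h2].
    by split=> [j|i]; [rewrite azP; exact: h1|rewrite uwP; exact: h2].
  move=> [h1 h2]; apply/andP; split; apply/prodf_neq0 => i _.
    by rewrite -azP; exact: h1.
  by rewrite -uwP; exact: h2.
exists ((s + s) + l)%N, eqs, ineq => ab; split.
  move=> [z [w [Ee [Sd Qd] bE]]].
  exists (row_mx (row_mx z w) (quotients R S (row_mx (lsubmx ab) z))).
  set v := row_mx _ _.
  have eE : e_ v = row_mx z w by rewrite /e_ /eu_ row_mxKr row_mxKl.
  have aE : a_ v = lsubmx ab by rewrite /a_ /ab_ row_mxKl.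
  have bvE : b_ v = rsubmx ab by rewrite /b_ /ab_ row_mxKl.
  have uE : u_ v = quotients R S (row_mx (lsubmx ab) z) by rewrite /u_ /eu_ !row_mxKr.
  have zE : z_ v = z by rewrite /z_ eE row_mxKl.
  have wE : w_ v = w by rewrite /w_ eE row_mxKr.
  split; last by apply/ineqP; rewrite aE uE zE wE.
  apply/eqsP; rewrite aE bvE uE zE wE; split=> [p ptau|j|i].
  - by rewrite eE; exact: tau_E.
  - by rewrite mxE divfK //; exact: Sd.
  - by rewrite bE mxE divfK //; exact: Qd.
move=> [eu [/eqsP[h1 h2 h3] /ineqP[Sd Qd]]].
set v := row_mx _ eu in h1 h2 h3 Sd Qd.
have aE : a_ v = lsubmx ab by rewrite /a_ /ab_ row_mxKl.
have bvE : b_ v = rsubmx ab by rewrite /b_ /ab_ row_mxKl.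
have uE : u_ v = quotients R S (row_mx (a_ v) (z_ v)).
  by apply/rowP => j; rewrite [RHS]mxE -h2 mulfK //; exact: Sd.
rewrite uE in Qd; rewrite aE in uE Sd Qd.
exists (z_ v), (w_ v); split=> //.
  have -> : row_mx (z_ v) (w_ v) = e_ v by exact: hsubmxK.
  exact: Etau.
apply/rowP => i; rewrite [RHS]mxE -bvE.
rewrite /trace_point -uE -h3 mulfK // uE; exact: Qd.
Qed.

Definition chart_square : set (affine_pts k (r + r)) :=
  [set row_mx (x a) (x b : 'rV[k]_r) | a in V0 & b in V0].

Lemma graph_in_transport_graph n : generically (fun a => [/\ V0 a, V0 (iter n phi a) &
  transport_graph (row_mx (x a) (x (iter n phi a) : 'rV[k]_r))]).
Proof.
have [z [w [Ezw gen]]] := graph_parameter n.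
apply: genericallyS gen => a [V0a V0na ga xna]; split=> //.
exists z, w; rewrite row_mxKl row_mxKr; split=> //.
exact: subset_closure.
Qed.

(** Grouping the monomials of f by their two halves writes f(x a, x b) as a sum of
    products c_i(a) u_i(b), to which [descent] applies. *)
Lemma vanishing_on_graphs (f : {mpoly k[r + r]}) :
  (forall n, generically (fun a => V0 a ->  V0 (iter n phi a) ->
    peval f (row_mx (x a) (x (iter n phi a) : 'rV[k]_r)) = 0)) ->
  forall v, chart_square v -> peval f v = 0.
Proof.
move=> f0.
have gV0 : generically V0 by apply: generically_open V_irr (chart_open x_chart) V0_ne.
pose M i := nth 0%MM (msupp f) i.
pose c i a := f@_(M i) * \prod_(j < r) (x a : 'rV[k]_r) ord0 j ^+ M i (lshift r j).
pose u i b := \prod_(j < r) (x b : 'rV[k]_r) ord0 j ^+ M i (rshift r j).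
have fE a b : peval f (row_mx (x a) (x b : 'rV[k]_r)) =
    \sum_(i < size (msupp f)) c i a * u i b.
  rewrite /peval mevalE (big_nth 0%MM) big_mkord; apply: eq_bigr => i _.
  rewrite -/(M i) /c /u -mulrA big_split_ord /=; congr (_ * (_ * _)).
    by apply: eq_bigr => j _; rewrite row_mxEl.
  by apply: eq_bigr => j _; rewrite row_mxEr.
have xr a j : V0 a -> reg a (fun w => (x w : 'rV[k]_r) ord0 j).
  by move=> V0a; exact: coord_regular_at (chart_regular x_chart V0a).
have rc i a : V0 a -> reg a (c i).
  move=> V0a; apply: reg_mul; first exact: reg_cst.
  by apply: reg_prod => j; apply: reg_exp; exact: xr.
have ru i a : V0 a -> reg a (u i).
  by move=> V0a; apply: reg_prod => j; apply: reg_exp; exact: xr.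
have gen : generically (fun b => generically (fun a =>
    \sum_(i < size (msupp f)) c i a * u i b = 0)).
  apply: (descent V_irr no_inv) => [i _|n].
    by apply: genericallyS gV0 => a; exact: rc.
  apply: genericallyS (genericallyI (genericallyI gV0
    (generically_iter n V_irr (automorphism_meets_opens phi_aut) gV0)) (f0 n)).
  by move=> a [[V0a V0na] fa]; rewrite -fE; exact: fa.
have f0a a : V0 a ->
    generically (fun b => \sum_(i < size (msupp f)) c i a * u i b = 0).
  move=> V0a; apply: genericallyS gen => b gb.
  have ra : reg a (fun a' => \sum_(i < size (msupp f)) c i a' * u i b).
    by apply: reg_sum => i; apply: reg_mul; [exact: rc|exact: reg_cst].
  have cl := closure_dense (x := a) (generically_dense gb).
  by apply: (reg_eq_closure cl ra (reg_cst a 0)).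
move=> _ [a V0a [b V0b <-]]; rewrite fE.
have rb : reg b (fun b' => \sum_(i < size (msupp f)) c i a * u i b').
  by apply: reg_sum => i; apply: reg_mul; [exact: reg_cst|exact: ru].
have cl := closure_dense (x := b) (generically_dense (f0a a V0a)).
by apply: (reg_eq_closure cl rb (reg_cst b 0)).
Qed.

Lemma chart_square_irreducible (f g : {mpoly k[r + r]}) :
  (forall v, chart_square v -> peval f v * peval g v = 0) ->
  (forall v, chart_square v -> peval f v = 0) \/
  (forall v, chart_square v -> peval g v = 0).
Proof.
move=> fg; have cc := chart_prod x_chart x_chart.
have VV_irr := prod_irreducible V_irr V_irr.
have ne (h : {mpoly k[r + r]}) : ~ (forall v, chart_square v -> peval h v = 0) ->
    generically (fun p : prod_space V V =>
      (V0 p.1 /\ V0 p.2) /\ peval h (prod_chart x x p) != 0).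
  move=> nh; have [v [Xv hv]] : exists v, chart_square v /\ peval h v != 0.
    apply: contrapT => nv; apply: nh => v Xv; apply/eqP/negPn/negP => hv.
    by apply: nv; exists v.
  have [a V0a [b V0b abv]] := Xv; rewrite -abv in hv.
  pose p : prod_space V V := (a, b).
  have V0p : V0 p.1 /\ V0 p.2 by [].
  apply: (generically_near (x := p) VV_irr); apply: filterI.
    exact: open_near (chart_open cc) V0p.
  exact: reg_neq0 (regular_at_reg (chart_regular cc V0p) (peval_reg _ h)) hv.
apply: contrapT => /not_orP[/ne nf /ne ng].
have [[a b] [[[V0a V0b] fp] [_ gp]]] :=
  generically_nonempty VV_irr (genericallyI nf ng).
have /eqP := fg (row_mx (x a) (x b)) (ex_intro2 _ _ a V0a (ex_intro2 _ _ b V0b erefl)).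
by rewrite mulf_eq0 (negbTE fp) (negbTE gp).
Qed.

Lemma dense_orbit : exists a, dense [set iter n phi a | n in [set: nat]].
Proof.
have [e [ps [q Dproj]]] := parametrization_projection.
have [|||f [[v [a V0a [b V0b abv]] fv] fD]] := @chevalley k _ e ps q chart_square.
- exact: chart_square_irreducible.
- move=> f f0 v Xv; apply: vanishing_on_graphs Xv => n.
  apply: genericallyS (graph_in_transport_graph n) => a [V0a V0na Da] _ _.
  by apply: f0; [exists a => //; exists (iter n phi a)|exact/Dproj].
- by have [a V0a] := V0_ne; exists (row_mx (x a) (x a)); exists a => //; exists a.
exists a => O O0 oO; rewrite -abv in fv.
have V0O : generically (fun b => V0 b /\ peval f (row_mx (x a) (x b : 'rV[k]_r)) != 0).
  apply: (generically_near (x := b) V_irr); apply: filterI.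
    exact: open_near (chart_open x_chart) V0b.
  apply: reg_neq0 fv.
  have rb := row_mx_regular (cst_regular (x a) b) (chart_regular x_chart V0b).
  exact: regular_at_reg rb (peval_reg _ f).
have [c Oc [V0c fc]] := generically_meets V0O oO O0.
have [p pc pO] := (affine_nbhsP _ _).1 (chart_nbhs x_chart V0c (open_near oO Oc)).
apply: contrapT => nO; move/negP: pc; apply.
have /Dproj[z [w [Ezw ga cE]]] : projection ps q (row_mx (x a) (x c : 'rV[k]_r)).
  by apply: fD fc; exists a => //; exists c.
rewrite row_mxKl row_mxKr in ga cE; rewrite cE; apply/eqP.
apply: (orbit_closure V0a Ezw ga) => n V0n; apply/eqP/negPn/negP => pn.
by apply: nO; exists (iter n phi a); split; [exact: pO V0n erefl|exists n].
Qed.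

End Assembly.

Theorem theorem1p7 (k : closedFieldType) (k_char0 : [pchar k] =i pred0)
    (V : kspace k) (V_var : irreducible_variety V)
    (phi : V -> V) (phi_aut : automorphism phi)
    (phi_iso : isotrivial (rat_of_morphism (proj1 phi_aut)))
    (no_inv : ~ exists lam : ratfun V,
       invariant_ratfun (rat_of_morphism (proj1 phi_aut)) lam /\ ~ constant_ratfun lam) :
  exists a : V, dense [set iter n phi a | n in [set: nat]].
Proof.
have [V0 [r [x [x_chart V0_ne x_closed]]]] := variety_chart V_var.
have [Z [s [t [tn [l [R [S [P [Q [Z_irr param]]]]]]]]]] :=
  isotrivial_parametrization V_var x_chart V0_ne phi_iso.
have V_lim := separated_unique_limits V_var.1.1.
exact: (dense_orbit V_var.2 V_lim no_inv x_chart V0_ne x_closed Z_irr param).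
Qed.
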